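(* Let $\mathfrak F$ be a saturated formation containing $\mathfrak U$, and let $X\le E$ be normal subgroups of a finite group $G$ with $G/E\in\mathfrak F$. Let $\tau$ be an inductive subgroup functor. Suppose that for every non-cyclic Sylow subgroup $P$ of $X$, every cyclic subgroup of $P$ of prime order, and also every cyclic subgroup of $P$ of order $4$ if $P$ is a non-abelian $2$-group, is $\mathfrak U_\tau$-supplemented in $G$. Suppose that at least one of the following holds: (i) $\tau$ is hereditary and $\Phi$-quasiregular, and $X=E$; (ii) $\tau$ is hereditary and quasiregular, $E$ is soluble and $X=F(E)$; (iii) $\tau$ is regular, and $X=F^*(E)$ or $X=E$. Then $G\in\mathfrak F$.
   Context: All groups are finite. $\mathfrak U$ denotes the class of supersoluble groups; $F(E)$ is the Fitting subgroup and $F^*(E)$ the generalized Fitting subgroup. For a class of groups $\mathfrak F$, a chief factor $H/K$ of $G$ is $\mathfrak F$-central if $(H/K)\rtimes(G/C_G(H/K))\in\mathfrak F$; $Z_{\mathfrak F}(G)$ is the product of all normal subgroups $N$ of $G$ such that every chief factor of $G$ below $N$ is $\mathfrak F$-central. For $K\le H\le G$, the pair $(K,H)$ satisfies the $\mathfrak F$-supplement condition in $G$ if there is $T\le G$ with $HT=G$ and $H\cap T\subseteq KZ_{\mathfrak F}(T)$. A subgroup functor $\tau$ assigns to each group $G$ a set $\tau(G)$ of subgroups of $G$ with $1\in\tau(G)$ and $\theta(\tau(G))=\tau(\theta(G))$ for every isomorphism $\theta:G\to G^*$; members are $\tau$-subgroups. $\tau$ is inductive if $HN/N\in\tau(G/N)$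 whenever $H\in\tau(G)$, $N\trianglelefteq G$; hereditary if inductive and $H\in\tau(E)$ whenever $H\le E\le G$ and $H\in\tau(G)$. For $\tau$, consider the property: ''whenever $H\in\tau(G)$ is a $p$-group ($p$ prime) and $N$ is a minimal normal subgroup of $G$ [of the indicated type], $|G:N_G(H\cap N)|$ is a power of $p$''. $\tau$ is regular if this holds for all groups $G$ and all minimal normal $N$; quasiregular if it holds for all groups $G$ and all abelian minimal normal $N$; $\Phi$-quasiregular if it holds for all primitive groups $G$ (groups with a maximal subgroup of trivial core) and all abelian minimal normal $N$. With $H_G$ the core of $H$, $H$ is $\mathfrak F_\tau$-supplemented in $G$ if for some $\tau$-subgroup $\bar S$ of $G/H_G$ with $\bar S\le H/H_G$ the pair $(\bar S,H/H_G)$ satisfies the $\mathfrak F$-supplement condition in $G/H_G$. *)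

(* Defs.v *)
From HB Require Import structures.
From mathcomp Require Import all_boot all_fingroup all_solvable.
Set Implicit Arguments. Unset Strict Implicit. Unset Printing Implicit Defensive.
Import GroupScope.

Definition group_class := forall gT : finGroupType, {group gT} -> Prop.

Definition supersoluble : group_class := fun gT G =>
  exists s : seq {group gT},
    [/\ path [rel A B : {group gT} | (A \subset B) && cyclic (B / A)] 1%G s,
        last 1%G s = G & all (fun A : {group gT} => A <| G) s].

Definition formation (F : group_class) : Prop :=
  [/\ (forall (gT rT : finGroupType) (G : {group gT}) (G' : {group rT}),
          G \isog G' -> F gT G -> F rT G'),
      (forall (gT : finGroupType) (G N : {group gT}),
          N <| G -> F gT G -> F _ (G / N)%G) &
      (forall (gT : finGroupType) (G N1 N2 : {group gT}),
          N1 <| G -> N2 <| G -> F _ (G / N1)%G -> F _ (G / N2)%G ->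
          F _ (G / (N1 :&: N2))%G)].

Definition saturated (F : group_class) : Prop :=
  forall (gT : finGroupType) (G : {group gT}), F _ (G / 'Phi(G))%G -> F gT G.

Definition secC (gT : finGroupType) (G H K : {group gT}) : {set gT} :=
  G :&: coset K @*^-1 'C(H / K).

(* The chief factor H/K of G is F-central: (H/K) ⋊ (G/C_G(H/K)) ∈ F,
   the semidirect product being given up to isomorphism: S = A ⋊ B with
   A ≅ H/K via a, B ≅ G/C_G(H/K) via b, and the action of B on A being
   conjugation in G. *)
Definition Fcentral (F : group_class) (gT : finGroupType) (G H K : {group gT}) : Prop :=
  exists (rT : finGroupType) (S A B : {group rT})
         (a : {morphism H >-> rT}) (b : {morphism G >-> rT}),
    [/\ A ><| B = S, a @* H = A, b @* G = B & 'ker a = K] /\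
    'ker b = secC G H K /\
    (forall h g, h \in H -> g \in G -> a (h ^ g) = a h ^ b g) /\ F rT S.

Definition Fhyper_adm (F : group_class) (gT : finGroupType) (G N : {group gT}) : Prop :=
  N <| G /\ forall H K : {group gT}, chief_factor G K H -> H \subset N -> Fcentral F G H K.

Definition is_ZF (F : group_class) (gT : finGroupType) (G : {group gT}) (Z : {set gT}) : Prop :=
  exists A : {set {group gT}},
    (forall N : {group gT}, N \in A <-> Fhyper_adm F G N) /\
    Z = << \bigcup_(N in A) N >>.

Definition Fsupp_cond (F : group_class) (gT : finGroupType) (G K H : {group gT}) : Prop :=
  exists (T : {group gT}) (Z : {set gT}),
    [/\ T \subset G, H * T = G, is_ZF F T Z & H :&: T \subset K * Z].

(* Subgroup functors: tau gT G H means H ∈ τ(G). *)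
Definition sfunctor := forall gT : finGroupType, {group gT} -> {group gT} -> Prop.

Definition subgroup_functor (tau : sfunctor) : Prop :=
  [/\ (forall (gT : finGroupType) (G H : {group gT}), tau gT G H -> H \subset G),
      (forall (gT : finGroupType) (G : {group gT}), tau gT G 1%G) &
      (forall (gT rT : finGroupType) (G : {group gT}) (G' : {group rT})
              (f : {morphism G >-> rT}), isom G G' f ->
         forall H : {group gT}, H \subset G -> (tau gT G H <-> tau rT G' (f @* H)%G))].

Definition inductive (tau : sfunctor) : Prop :=
  forall (gT : finGroupType) (G H N : {group gT}),
    tau gT G H -> N <| G -> tau _ (G / N)%G (H / N)%G.

Definition hereditary (tau : sfunctor) : Prop :=
  inductive tau /\
  forall (gT : finGroupType) (G E H : {group gT}),
    tau gT G H -> H \subset E -> E \subset G -> tau gT E H.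

Definition regular (tau : sfunctor) : Prop :=
  forall (gT : finGroupType) (G H N : {group gT}) (p : nat),
    prime p -> tau gT G H -> p.-group H -> minnormal N G ->
    p.-nat #|G : 'N_G(H :&: N)|.

Definition quasiregular (tau : sfunctor) : Prop :=
  forall (gT : finGroupType) (G H N : {group gT}) (p : nat),
    prime p -> tau gT G H -> p.-group H -> minnormal N G -> abelian N ->
    p.-nat #|G : 'N_G(H :&: N)|.

Definition primitive (gT : finGroupType) (G : {group gT}) : Prop :=
  exists M : {group gT}, maximal M G /\ gcore M G = 1.

Definition phi_quasiregular (tau : sfunctor) : Prop :=
  forall (gT : finGroupType) (G H N : {group gT}) (p : nat),
    primitive G ->
    prime p -> tau gT G H -> p.-group H -> minnormal N G -> abelian N ->
    p.-nat #|G : 'N_G(H :&: N)|.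

Definition Ftau_supp (F : group_class) (tau : sfunctor) (gT : finGroupType)
    (G H : {group gT}) : Prop :=
  H \subset G /\
  exists S : {group coset_of (gcore H G)},
    [/\ tau _ (G / gcore H G)%G S, S \subset H / gcore H G &
        Fsupp_cond F (G / gcore H G)%G S (H / gcore H G)%G].

Definition quasisimple (gT : finGroupType) (Q : {group gT}) : bool :=
  ([~: Q, Q] == Q) && simple (Q / 'Z(Q)).

Definition layer (gT : finGroupType) (G : {group gT}) : {set gT} :=
  << \bigcup_(Q : {group gT} | (Q <|<| G) && quasisimple Q) Q >>.

Definition genFitting (gT : finGroupType) (G : {group gT}) : {set gT} :=
  'F(G) <*> layer G.

(* Main.v *)
(** For a cyclic p-subgroup [H] of [G], U_tau-supplementation leaves three cases:
    [H] has a proper supplement in [G], [H] lies in a normal subgroup all of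
    whose [G]-chief factors are cyclic ("hypercyclic"), or [H / H_G] is a
    tau-subgroup of [G / H_G].

    The key step concerns a normal p-subgroup [D] having a largest proper
    [G]-invariant subgroup [L], all of whose elements generate such an [H].
    Choose [x] in [D - L] central modulo [L] in a Sylow p-subgroup: a proper
    supplement of [<x>] gives [D = <x> L]; and if [<x>] is a tau-subgroup then
    quasiregularity makes [<x> L] normal.  In all cases [|D : L| = p].

    (ii), (iii): if [X] is not hypercyclic, let [K <= X] be a minimal
    non-hypercyclic normal subgroup of [G], with largest proper invariant
    subgroup [L].  Then [K <= G'], so [K] stabilises every hypercyclic series,
    and [K] is a p-group or perfect with [L = Z(K)].  In the first case the maps
    [d -> [a, d]] and [d -> d^p] (or [d^4]) pull the series of [L] back to [K]
    unless [L <= Z(K)] and [K] has exponent [p] (or 4), where the key step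
    applies.  In the second, for the least prime [p] dividing [|K|], elements of
    order [p] (and 4) are central, so p'-elements normalising p-subgroups
    centralise them and [K] is p-nilpotent by Frobenius' theorem.  The same [K],
    chosen in [E], passes from [F(E)] or [F*(E)] to [E]: a perfect [K] would
    contain a quasisimple subnormal subgroup of [E].  Finally [G] is in [F]
    because a normal subgroup of prime order can be lifted from [F].

    (i): [E] is p-nilpotent for the least prime [p] by the key step and
    Frobenius' theorem, which reduces to [E = P] a p-group.  If [G] is not in
    [F], take a maximal [M] (in [F] by induction), [G = D M], [L = D :&: M].
    When [[D, L] <> 1], the module [D / L] embeds in functions [U -> Z] for
    [Z < U <= L]; these functions lie in the Frattini subgroup of a twisted
    wreath product built from [M], up to a quotient in [F], so saturation
    puts [D / L] with the action of [G] in [F].  Otherwise the power map or the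
    key step concludes. *)
Require Import Defs.
From HB Require Import structures.
From mathcomp Require Import all_boot all_fingroup all_solvable.
From mathcomp Require ssralg.
Set Implicit Arguments. Unset Strict Implicit. Unset Printing Implicit Defensive.
Import GroupScope.

(** * Hypercyclic normal subgroups and supplements *)

Lemma cosetpre_normal_quotient (gT : finGroupType) (G N : {group gT})
    (R : {group coset_of N}) :
  N <| G -> R <| G / N -> coset N @*^-1 R <| G.
Proof. by move=> nN nR; rewrite -(quotientGK nN) cosetpre_normal. Qed.

(** A chain of subgroups normal in [G] with prime steps; equivalently, every chief factor of [G]
    below the top has prime order. The inductive form lets a map of subgroups be followed along the
    chain. *)
Inductive hypercyclic (gT : finGroupType) (G : {group gT}) : {group gT} -> Prop :=
| Hypercyclic1 : hypercyclic G 1%G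
| HypercyclicS (A B : {group gT}) of
    hypercyclic G A & A \subset B & B <| G & prime #|B : A| : hypercyclic G B.

Section Index.
Variable gT : finGroupType.
Implicit Types A B E G N : {group gT}.

Lemma index_setI_dvd A B E : A <| B -> #|B :&: E : A :&: E| %| #|B : A|.
Proof.
case/andP=> sAB nAB.
have -> : #|B :&: E : A :&: E| = #|B :&: E : A|.
  by rewrite -(indexgI _ A) setIAC (setIidPr sAB).
have nA : B :&: E \subset 'N(A) by rewrite subIset ?nAB.
rewrite -indexMg -norm_joinEr //.
by rewrite indexSg ?joing_subl // join_subG sAB subsetIl.
Qed.

Lemma index_joing_dvd G A B N : A <| G -> N <| G -> A \subset B -> B <| G ->
  #|N <*> B : N <*> A| %| #|B : A|.
Proof.
move=> nAG nNG sAB nBG.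
have [sAG nA] := andP nAG; have [sNG nN] := andP nNG; have [sBG nB] := andP nBG.
have nNA : N <*> A <| G by rewrite normalY.
have -> : N <*> B = (N <*> A) * B.
  rewrite -norm_joinEr ?(subset_trans sBG) ?normal_norm //.
  by rewrite -joingA (joing_idPr sAB).
by rewrite indexMg indexgS ?joing_subr.
Qed.

Lemma dvdn_prime_or1 m p : prime p -> m %| p -> m = 1%N \/ prime m.
Proof. by move=> pr /(prime_nt_dvdP pr); case: eqP => [->|_ h]; [left | right; rewrite h]. Qed.
End Index.

Section Hypercyclic.
Variable gT : finGroupType.
Implicit Types A B E G H N K L Z : {group gT}.

Lemma hypercyclic_normal G N : hypercyclic G N -> N <| G.
Proof. by case=> // ; rewrite normal1. Qed.

Lemma hypercyclic_ext G A B p : hypercyclic G A -> A \subset B -> B <| G ->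
  prime p -> #|B : A| %| p -> hypercyclic G B.
Proof.
move=> hA sAB nB pr /(dvdn_prime_or1 pr) [i1|prB]; last exact: (HypercyclicS hA).
suff -> : B = A by [].
by apply: val_inj; rewrite /= (index1g sAB i1).
Qed.

End Hypercyclic.

Section HypercyclicTransport.
Variable gT : finGroupType.
Implicit Types A B E G H N K L Z : {group gT}.

(** Asking only that indices divide lets steps of the image chain collapse, a divisor of a prime
    being 1 or that prime. Intersections, quotients, preimages and joins are all instances. *)
Lemma hypercyclic_transport (rT : finGroupType) G (G' : {group rT})
    (f : {group gT} -> {group rT}) N :
  hypercyclic G' (f 1%G) ->
  (forall A B, hypercyclic G A -> hypercyclic G B -> A \subset B ->
     [/\ f A \subset f B, f B <| G' & #|f B : f A| %| #|B : A|]) ->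
  hypercyclic G N -> hypercyclic G' (f N).
Proof.
move=> h1 hf; elim=> // A B hA IH sAB nB prB.
have hB := HypercyclicS hA sAB nB prB.
have [s n d] := hf _ _ hA hB sAB.
exact: hypercyclic_ext IH s n prB d.
Qed.

End HypercyclicTransport.

Section HypercyclicTheory.
Variable gT : finGroupType.
Implicit Types A B E G H N K L Z : {group gT}.

Lemma hypercyclic_restrict G E N : E \subset G -> hypercyclic G N ->
  hypercyclic E (N :&: E)%G.
Proof.
move=> sEG; apply: (@hypercyclic_transport _ _ _ _ (fun A => A :&: E)%G).
  suff -> : (1 :&: E)%G = 1%G :> {group gT} by constructor.
  by apply: val_inj => /=; apply: (setIidPl (sub1G E)).
move=> A B hA hB sAB; split; first by rewrite setSI.
  have /andP[_ nB] := hypercyclic_normal hB.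
  by rewrite /normal subsetIr normsI ?normG // (subset_trans sEG).
apply: index_setI_dvd; apply: normalS sAB _ (hypercyclic_normal hA).
by case/andP: (hypercyclic_normal hB).
Qed.

Lemma hypercyclic_quotient G K N : K <| G -> hypercyclic G N ->
  hypercyclic (G / K)%G (N / K)%G.
Proof.
move=> /andP[_ nK]; apply: (@hypercyclic_transport _ _ _ _ (fun A => A / K)%G).
  suff -> : (1 / K)%G = 1%G by constructor.
  by apply: val_inj; rewrite /= quotient1.
move=> A B hA hB sAB; have /andP[sBG nB] := hypercyclic_normal hB.
split; rewrite ?quotientS ?quotient_normal ?(hypercyclic_normal hB) //.
by apply: index_quotient; rewrite subIset // (subset_trans sBG).
Qed.

Lemma hypercyclic_cosetpre G K (N : {group coset_of K}) :
  hypercyclic G K -> hypercyclic (G / K)%G N ->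
  hypercyclic G (coset K @*^-1 N)%G.
Proof.
move=> hK; have nKG := hypercyclic_normal hK.
move=> hN; refine (@hypercyclic_transport _ _ (G / K)%G G (fun D => coset K @*^-1 D)%G N _ _ hN).
  suff -> : (coset K @*^-1 1)%G = K by [].
  by apply: val_inj; rewrite /= -kerE ker_coset.
move=> A B hA hB sAB; split; rewrite ?morphpreS ?index_cosetpre //.
by rewrite -(quotientGK nKG) cosetpre_normal (hypercyclic_normal hB).
Qed.

Lemma hypercyclicY G A B : hypercyclic G A -> hypercyclic G B ->
  hypercyclic G (A <*> B)%G.
Proof.
move=> hA; have nA := hypercyclic_normal hA.
apply: (@hypercyclic_transport _ _ _ _ (fun B => A <*> B)%G).
  suff -> : (A <*> 1)%G = A by [].
  by apply: val_inj; rewrite /= joingG1.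
move=> B1 B2 hB1 hB2 sB; have nB2 := hypercyclic_normal hB2.
have nB1 := hypercyclic_normal hB1.
by split; [rewrite genS ?setUS | rewrite normalY | apply: index_joing_dvd nB1 _ _ nB2].
Qed.

Lemma hypercyclic_sub G A B : hypercyclic G B -> A \subset B -> A <| G ->
  hypercyclic G A.
Proof.
move=> hB sAB nA.
suff : hypercyclic G (B :&: A)%G.
  by congr (hypercyclic G _); apply: val_inj; apply/setIidPr.
apply: (@hypercyclic_transport _ _ _ _ (fun B => B :&: A)%G _ _ _ hB).
  suff -> : (1 :&: A)%G = 1%G :> {group gT} by constructor.
  by apply: val_inj => /=; apply: (setIidPl (sub1G A)).
move=> B1 B2 hB1 hB2 sB; have nB2 := hypercyclic_normal hB2.
split; rewrite ?setSI ?normalI //.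
apply: index_setI_dvd; apply: normalS sB _ (hypercyclic_normal hB1).
by case/andP: nB2.
Qed.

(** Climb the chain of [Z] to the first step from [A] to [B] with [B :&: K] outside [L]. There
    [K = L (B :&: K)], so [|K : L|] divides [|B : A|]. *)
Lemma hypercyclic_chief G Z K L : hypercyclic G Z -> K <| G -> L <| G ->
  L \proper K -> K \subset Z ->
  (forall N, N <| G -> L \subset N -> N \subset K -> N :=: L \/ N :=: K) ->
  prime #|K : L|.
Proof.
move=> hZ nK nL pLK sKZ chief; have sLK := proper_sub pLK.
suff [sub|//] : Z :&: K \subset L \/ prime #|K : L|.
  by case/negP: (proper_subn pLK); rewrite -{1}(setIidPr sKZ).
elim: hZ {sKZ} => [|A B hA [sA|] sAB nB prB]; first by left; rewrite subIset ?sub1G.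
  have [sB|nsB] := boolP (B :&: K \subset L); [by left | right].
  have nBK : B :&: K <| G by rewrite normalI.
  have defK : K :=: L <*> (B :&: K).
    have [|||e|//] := chief (L <*> (B :&: K))%G.
    - by rewrite normalY.
    - by rewrite joing_subl.
    - by rewrite join_subG sLK subsetIr.
    by case/negP: nsB; rewrite -{1}e joing_subr.
  have d : #|K : L| %| #|B : A|.
    have nAB : A <| B by apply: normalS sAB _ (hypercyclic_normal hA); case/andP: nB.
    have -> : #|K : L| = #|B :&: K : L|.
      rewrite {1}defK norm_joinEr ?indexMg //.
      by rewrite (subset_trans _ (normal_norm nL)) ?(normal_sub nBK).
    by apply: dvdn_trans (index_setI_dvd K nAB); apply: indexgS.
  have [i1|//] := dvdn_prime_or1 prB d.
  by case/negP: (proper_subn pLK); rewrite (index1g sLK i1).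
by right.
Qed.

Lemma cyclic_hypercyclic G N : N <| G -> cyclic N -> hypercyclic G N.
Proof.
move=> nN cN; move: {2}#|N| (leqnn #|N|) => n; elim: n => [|n IH] in N nN cN *.
  by rewrite leqNgt cardG_gt0.
move=> leN; have [N1|ntN] := eqVneq N 1%G; first by rewrite N1; constructor.
have [M maxM _] : exists2 M : {group gT}, maximal M N & 1%G \subset M.
  by have [e|//] := @maximal_exists _ 1%G N (sub1G N); case/eqP: ntN; apply: val_inj.
have sMN := proper_sub (maxgroupp maxM).
have nM : M <| G by apply: (char_normal_trans _ nN); rewrite sub_cyclic_char.
have solN := abelian_sol (cyclic_abelian cN).
apply: (@HypercyclicS _ _ M) => //.
  apply: IH => //; first exact: cyclicS cN.
  by rewrite -ltnS; apply: leq_trans leN; rewrite proper_card ?(maxgroupp maxM).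
have nMN : M <| N by rewrite -sub_abelian_normal ?cyclic_abelian.
apply: index_maxnormal_sol_prime solN _.
apply/maxgroupP; split; first by rewrite (maxgroupp maxM) normal_norm.
by move=> H /andP[pH _] sH; apply: (maxgroupP maxM).2.
Qed.

Lemma hypercyclic_of_chief_prime G N : N <| G ->
  (forall H K, chief_factor G K H -> H \subset N -> prime #|H : K|) ->
  hypercyclic G N.
Proof.
move: {2}#|N| (leqnn #|N|) => n; elim: n => [|n IH] in N *.
  by rewrite leqNgt cardG_gt0.
move=> leN nN chN; have [N1|ntN] := eqVneq N 1%G; first by rewrite N1; constructor.
have [M maxM _] : {M : {group gT} | maxnormal M N G & 1%G \subset M}.
  apply: maxgroup_exists; rewrite norms1 andbT properE sub1G /=.
  by apply: contra ntN => /trivgP e; apply/eqP/val_inj.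
have chM : chief_factor G M N by rewrite /chief_factor maxM.
have /andP[pM nM] := maxgroupp maxM; have sM := proper_sub pM.
have nMG : M <| G by rewrite /normal nM (subset_trans sM) ?normal_sub.
apply: (@HypercyclicS _ _ M) => //; last exact: chN.
apply: IH => //; first by rewrite -ltnS (leq_trans _ leN) // proper_card.
by move=> H K chHK sHM; apply: chN => //; apply: subset_trans sM.
Qed.

End HypercyclicTheory.

(** * Chief factors and hypercentres for the supersoluble class *)

Lemma cyclic_minnormal_prime (gT : finGroupType) (G N : {group gT}) :
  minnormal N G -> cyclic N -> prime #|N|.
Proof.
move=> /mingroupP[/andP[ntN nN] minN] cN.
have pr : prime (pdiv #|N|) by rewrite pdiv_prime // cardG_gt1.
have [x Nx ox] := Cauchy pr (pdiv_dvd _).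
have chx : <[x]> \char N by rewrite sub_cyclic_char // cycle_subG.
rewrite -(minN <[x]>%G) //= -?[#|_|]/(#[x]) ?ox ?cycle_subG //.
rewrite cycle_eq1 -order_eq1 ox neq_ltn prime_gt1 ?orbT //=.
exact: char_norm_trans chx nN.
Qed.

(** The first term [D] of the series that meets [A] nontrivially contains [A], while the term [C]
    before it meets [A] trivially; so [A] embeds in the cyclic [D / C]. *)
Lemma supersoluble_minnormal_cyclic (gT : finGroupType) (S A : {group gT}) :
  supersoluble S -> minnormal A S -> A \subset S -> cyclic A.
Proof.
case=> s [ps lastS alls] /mingroupP[/andP[ntA nA] minA]; rewrite -lastS.
have : 1%G <| S by rewrite normal1.
have : A :&: 1%G = 1 by rewrite setIC; apply: (setIidPl (sub1G A)).
elim: s (1%G) ps alls {lastS} => [|D s IH] C /=.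
  by move=> _ _ e _ sA; case/eqP: ntA; rewrite -e; apply/esym/setIidPl.
case/andP=> /andP[sCD cD] ps /andP[nD alls] ac nC.
have [e|nt] := eqVneq (A :&: D) 1; first exact: IH.
move=> _; have sAD : A \subset D.
  rewrite -(minA (A :&: D)%G) ?subsetIl ?subsetIr //=.
  by rewrite nt normsI // normal_norm.
have nCA : A \subset 'N(C).
  by rewrite (subset_trans sAD) // (subset_trans (normal_sub nD)) ?normal_norm.
by rewrite (isog_cyclic (quotient_isog nCA _)) ?(cyclicS (quotientS _ sAD)) // setIC.
Qed.

(** The copy [A] of [H / K] is minimal normal in the supersoluble [S]: an [S]-invariant subgroup of
    [A] pulls back along [a] to a [G]-invariant subgroup between [K] and [H]. *)
Lemma supersoluble_Fcentral_prime (gT : finGroupType) (G H K : {group gT}) :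
  chief_factor G K H -> Fcentral supersoluble G H K -> prime #|H : K|.
Proof.
move=> /andP[maxK nHG] [rT [S [A [B [a [b [[defS aH bG ker_a] [_ [act sS]]]]]]]]].
have /andP[pKH nKG] := maxgroupp maxK.
have [nAS sBS defAB _ _] := sdprod_context defS.
have oA : #|A| = #|H : K|.
  by rewrite -aH card_morphim -ker_a setIid.
suff minA : minnormal A S.
  rewrite -oA; apply: (cyclic_minnormal_prime minA).
  exact: supersoluble_minnormal_cyclic sS minA (normal_sub nAS).
apply/mingroupP; split=> [|A1 /andP[ntA1 nA1] sA1].
  rewrite normal_norm // andbT -cardG_gt1 oA indexg_gt1.
  exact: proper_subn.
have sH1H : a @*^-1 A1 \subset H by rewrite subsetIl.
have defA1 : a @* (a @*^-1 A1) = A1 by rewrite morphpreK // aH.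
have [e|neq] := eqVneq (a @*^-1 A1) H; first by rewrite -defA1 e.
case/eqP: ntA1; rewrite -defA1.
have /maxgroupP[_ max] := maxK.
have -> : a @*^-1 A1 = K.
  apply: max (_ : K \subset (a @*^-1 A1)%G); last by rewrite -ker_a kerE morphpreS ?sub1G.
  rewrite properEneq neq sH1H /=; apply/subsetP=> g Gg; rewrite inE.
  apply/subsetP=> _ /imsetP[h /morphpreP[Hh A1h] ->].
  have Hhg : h ^ g \in H by rewrite memJ_norm // (subsetP (normal_norm nHG)).
  apply/morphpreP; split=> //; rewrite act // memJ_norm //.
  by apply: (subsetP nA1); apply: (subsetP sBS); rewrite -bG mem_morphim.
by rewrite -ker_a morphim_ker.
Qed.

Lemma is_ZF_hypercyclic (gT : finGroupType) (T Z : {group gT}) :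
  is_ZF supersoluble T Z -> hypercyclic T Z.
Proof.
case=> A [inA defZ].
suff [N hN defN] : exists2 N : {group gT}, hypercyclic T N & Z :=: N.
  by rewrite (_ : Z = N) //; apply: val_inj.
rewrite {}defZ; have : {subset A <= A} by [].
have -> : \bigcup_(N in A) (N : {set gT}) = \bigcup_(N <- enum A) (N : {set gT}).
  by rewrite big_enum.
have : {subset enum A <= A} by move=> N; rewrite mem_enum.
elim: (enum A) => [_ _|N s IH sub _].
  by exists 1%G; [constructor | rewrite big_nil gen0].
have [M hM eM] := IH (fun B sB => sub B (@mem_behead _ (N :: s) B sB)) (fun _ h => h).
exists (N <*> M)%G; last first.
  by rewrite big_cons /= -eM -joingE joing_idr.
apply: hypercyclicY => //; have /inA[nN cN] := sub N (mem_head _ _).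
apply: hypercyclic_of_chief_prime => // H K chHK sHN.
exact: (supersoluble_Fcentral_prime chHK (cN H K chHK sHN)).
Qed.

(** The later arguments use supplementation only through this consequence, which passes to subgroups
    containing [H] when [tau] is hereditary, and to quotients by normal subgroups of order prime to
    [|H|]. *)
Definition tame (tau : sfunctor) (gT : finGroupType) (G H : {group gT}) : Prop :=
  [\/ exists2 T : {group gT}, T \proper G & H * T = G,
      exists2 Z : {group gT}, hypercyclic G Z & H \subset Z
    | tau _ (G / gcore H G)%G (H / gcore H G)%G].

Lemma gcore_hypercyclic (gT : finGroupType) (G H : {group gT}) :
  H \subset G -> cyclic H -> hypercyclic G (gcore_group H G).
Proof.
move=> sHG cH; apply: cyclic_hypercyclic; last exact: cyclicS (gcore_sub H G) cH.
exact: gcore_normal.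
Qed.

(** A proper [T] pulls back to a proper supplement. Otherwise [H / H_G] lies in [S Z]; subgroups of
    a cyclic p-group form a chain, so it equals [S] or lies in [Z], and [Z] has a hypercyclic
    preimage because [H_G] is cyclic. *)
Lemma Ftau_supp_tame (tau : sfunctor) (gT : finGroupType) (G H : {group gT}) (p : nat) :
  p.-group H -> cyclic H -> Ftau_supp supersoluble tau G H -> tame tau G H.
Proof.
move=> pH cH [sHG [S [tS sS [T [Z [sT HT defZ cap]]]]]].
have nK : gcore H G <| G by apply: gcore_normal.
have nKH : H \subset 'N(gcore H G) := subset_trans sHG (normal_norm nK).
have [e|neq] := eqVneq (T : {set _}) (G / gcore H G); last first.
  constructor 1; exists (coset (gcore H G) @*^-1 T)%G.
    rewrite properEneq sub_cosetpre_quo // sT andbT.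
    apply: contra neq => /eqP h; apply/eqP; rewrite -[LHS]cosetpreK.
    exact: (congr1 (fun A => A / gcore H G) h).
  have -> : H * (coset (gcore H G) @*^-1 T) = coset (gcore H G) @*^-1 (H / gcore H G * T).
    by rewrite cosetpreM quotientK // -(normC nKH) -mulgA (mulSGid (sub_cosetpre _)).
  exact: etrans (congr1 (fun A => coset (gcore H G) @*^-1 A) HT) (quotientGK nK).
have hZ : exists2 Z' : {group coset_of (gcore H G)}, hypercyclic (G / gcore H G)%G Z' & Z = Z'.
  case: defZ => A [inA eZ]; exists <<Z>>%G.
    by rewrite (_ : (G / gcore H G)%G = T) -?e; [apply: is_ZF_hypercyclic; exists A;
      split; rewrite // eZ /= genGid | apply: val_inj].
  by rewrite /= eZ genGid.
case: hZ => Z' hZ eZ.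
have {}cap : H / gcore H G \subset S * Z'.
  by move: cap; rewrite e /= (setIidPl (quotientS _ sHG)) eZ.
have [eS|neS] := eqVneq (S : {set _}) (H / gcore H G).
  by constructor 3; rewrite (_ : (H / gcore H G)%G = S) //; apply: val_inj.
constructor 2; exists (coset (gcore H G) @*^-1 Z')%G.
  by apply: hypercyclic_cosetpre => //; apply: gcore_hypercyclic.
rewrite -sub_quotient_pre //.
have cHK : cyclic (H / gcore H G) by rewrite quotient_cyclic.
have defH : S * (Z' :&: (H / gcore H G)) = H / gcore H G.
  by rewrite (group_modl Z' sS); apply/setIidPr.
have pHK : p.-group (H / gcore H G) by rewrite quotient_pgroup.
pose I := (Z' :&: (H / gcore H G))%G; rewrite -[_ :&: _]/(I : {set _}) in defH.
have sI : I \subset H / gcore H G by rewrite subsetIr.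
have [pS pI] := (pgroupS sS pHK, pgroupS sI pHK).
have chain : S \subset I \/ I \subset S.
  have [n on] := p_natP pS; have [m om] := p_natP pI.
  rewrite -(cardSg_cyclic cHK sS sI) -(cardSg_cyclic cHK sI sS) on om.
  by case: (leqP n m) => h; [left | right]; rewrite dvdn_exp2l // ltnW.
apply: subset_trans (subsetIl _ (H / gcore H G)).
case: chain => [/mulSGid|/mulGSid] eSI; first by rewrite -{1}defH eSI.
by case/eqP: neS; rewrite -defH eSI.
Qed.

(** * Restriction and quotients of tame subgroups *)

Section TauTransfer.
Variable tau : sfunctor.
Hypotheses (tauF : subgroup_functor tau) (tauI : inductive tau).

Lemma tau_third_isom (gT : finGroupType) (G H A N : {group gT}) :
  A <| G -> N <| G -> A \subset N -> H \subset G ->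
  tau (G / A / (N / A))%G (H / A / (N / A))%G <-> tau (G / N)%G (H / N)%G.
Proof.
move=> nA nN sAN sHG; have [f injf imf] := third_isom sAN nA nN.
have [_ _ tau_iso] := tauF.
have isof : isom (G / A / (N / A)) (G / N) f by apply/isomP; rewrite imf.
have := tau_iso _ _ _ _ _ isof (H / A / (N / A))%G.
rewrite /= !quotientS // (_ : (f @* _)%G = (H / N)%G); first exact.
by apply: val_inj; rewrite /= imf.
Qed.

Lemma tau_quotient (gT : finGroupType) (G H A N : {group gT}) :
  A <| G -> N <| G -> A \subset N -> H \subset G ->
  tau (G / A)%G (H / A)%G -> tau (G / N)%G (H / N)%G.
Proof.
move=> nA nN sAN sHG tH; apply/(tau_third_isom nA nN sAN sHG).
by apply: tauI; rewrite ?quotient_normal.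
Qed.

Lemma tau_quotient_quotient (gT : finGroupType) (G H N M : {group gT})
    (C : {group coset_of N}) :
  N <| G -> M <| G -> N \subset M -> H \subset G -> C :=: M / N ->
  tau (G / M)%G (H / M)%G -> tau (G / N / C)%G (H / N / C)%G.
Proof.
move=> nN nM sNM sHG eC tH; have -> : C = (M / N)%G by apply: val_inj.
exact/tau_third_isom.
Qed.

Lemma tame_restrict (gT : finGroupType) (G E H : {group gT}) :
  hereditary tau -> E \subset G -> H \subset E -> tame tau G H -> tame tau E H.
Proof.
move=> [_ her] sEG sHE; have sHG := subset_trans sHE sEG.
case=> [[T pT HT]|[Z hZ sHZ]|tH].
- constructor 1; exists (T :&: E)%G; last first.
    by rewrite /= group_modl // HT; apply/setIidPr.
  rewrite properE subsetIr /=; apply: contra (proper_subn pT) => sET.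
  have sHT : H \subset T := subset_trans sHE (subset_trans sET (subsetIl _ _)).
  by rewrite -HT mulSGid.
- constructor 2; exists (Z :&: E)%G; first exact: hypercyclic_restrict sEG hZ.
  by rewrite subsetI sHZ.
(* The core in [G] lies in the core in [E]: heredity gives a tau-subgroup of [E / H_G], and
   inductivity carries it to [E / H_E]. *)
constructor 3; have nc := gcore_normal sHG.
have ncE : gcore H G <| E.
  by apply: normalS nc => //; apply: subset_trans (gcore_sub H G) sHE.
have sc : gcore H G \subset gcore H E.
  by rewrite sub_gcore ?gcore_sub ?normal_norm.
apply: (tau_quotient ncE (gcore_normal sHE) sc sHE).
by apply: her tH _ _; rewrite quotientS.
Qed.

Lemma tame_quotient (gT : finGroupType) (G N H : {group gT}) :
  N <| G -> H \subset G -> coprime #|N| #|H| -> tame tau G H ->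
  tame tau (G / N)%G (H / N)%G.
Proof.
move=> nN sHG co; have nNH := subset_trans sHG (normal_norm nN).
case=> [[T pT HT]|[Z hZ sHZ]|tH].
- have sTG := proper_sub pT.
  (* [|N : N :&: T|] divides [|N|]; it also divides [|G : T| = |H : H :&: T|], hence [|H|].
     Coprimality makes it 1. *)
  have sNT : N \subset T.
    rewrite -indexg_eq1 -dvdn1 -(eqP co) dvdn_gcd dvdn_indexg.
    apply: dvdn_trans (dvdn_indexg H T); rewrite -(indexMg T N) -(indexMg T H).
    have /comm_group_setP cHT : group_set (H * T) by rewrite HT groupP.
    rewrite -cHT HT -norm_joinEl ?(subset_trans sTG) ?normal_norm //.
    by apply: indexSg; rewrite ?joing_subl // join_subG sTG normal_sub.
  constructor 1; exists (T / N)%G; last by rewrite -quotientMl //= HT.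
  rewrite properEneq quotientS // andbT; apply: contraTneq pT => e.
  by rewrite /proper sTG -(quotientSGK _ sNT) ?e ?subxx ?normal_norm.
- constructor 2; exists (Z / N)%G; first exact: hypercyclic_quotient.
  exact: quotientS.
constructor 3; set C := gcore _ _.
have sHN : (H / N)%G \subset (G / N)%G by apply: quotientS.
have nC : C <| G / N by apply: gcore_normal.
pose M := (coset N @*^-1 C)%G.
have nM : M <| G by rewrite -(quotientGK nN) cosetpre_normal.
have sNM : N \subset M by apply: sub_cosetpre.
have nc := gcore_normal sHG.
have sc : gcore H G \subset M.
  rewrite -sub_quotient_pre ?(subset_trans (normal_sub nc)) ?normal_norm //.
  rewrite sub_gcore /= ?quotientS ?gcore_sub //.
  by rewrite normal_norm // quotient_normal.
apply: (@tau_quotient_quotient _ G H N M (gcore_group (H / N) (G / N))) => //.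
  by rewrite /= cosetpreK.
exact: tau_quotient nc nM sc sHG tH.
Qed.

End TauTransfer.

(** * Maximal subgroups and saturated formations *)

Section MaximalSupplement.
Variable gT : finGroupType.
Implicit Types G D L M N T : {group gT}.

Lemma maximal_supplement G D M :
  D <| G -> maximal M G -> ~~ (D \subset M) -> D * M = G.
Proof.
move=> /andP[sDG nDG] /maxgroupP[pM max] nsD; have sM := proper_sub pM.
have nD := subset_trans sM nDG.
rewrite -norm_joinEr //; apply: contraNeq nsD => ne.
rewrite -(max (D <*> M)%G) ?joing_subl ?joing_subr //.
by rewrite properEneq ne join_subG sDG.
Qed.

Lemma not_sub_Phi G N : N \subset G -> ~~ (N \subset 'Phi(G)) ->
  exists2 M : {group gT}, maximal M G & ~~ (N \subset M).
Proof.
move=> sNG nsPhi; apply/exists_inP; apply: contraR nsPhi => /exists_inPn h.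
apply/bigcapsP=> M /predU1P[-> //|maxM].
by have := h _ maxM; rewrite negbK.
Qed.

Lemma Phi_normal_subset G D :
  D <| G -> 'Phi(D) \subset 'Phi(G).
Proof.
move=> nD; have nPhi : 'Phi(D) <| G := gFnormal_trans _ nD.
apply/bigcapsP=> M /predU1P[->|maxM]; first exact: normal_sub.
have [/(subset_trans (Phi_sub D)) //|nsD] := boolP (D \subset M).
apply: contraR nsD => nsPhi; have defG := maximal_supplement nPhi maxM nsPhi.
have eD : 'Phi(D) * (M :&: D) = D.
  by rewrite group_modl ?Phi_sub // defG (setIidPr (normal_sub nD)).
have := @Phi_nongen _ D (M :&: D); rewrite genGid -genM_join eD genGid => /(_ erefl) <-.
exact: subsetIl.
Qed.

(** [M] normalises the intersection, and so does [D], because the intersection contains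
    [D^](1)[: indeed]D^[(1)] lies in ['Phi(D)], hence in ['Phi(G)] and in [M]. *)
Lemma maximal_cap_normal (p : nat) G D M :
  D <| G -> p.-group D -> maximal M G -> ~~ (D \subset M) -> D :&: M <| G.
Proof.
move=> nD pD maxM nsD; have defG := maximal_supplement nD maxM nsD.
have sMG := proper_sub (maxgroupp maxM).
have sPhi : 'Phi(D) \subset M.
  exact: subset_trans (Phi_normal_subset nD) (Phi_sub_max maxM).
apply/andP; split; first by rewrite subIset ?(normal_sub nD).
rewrite -defG mulG_subG; apply/andP; split.
  apply: sub_der1_norm; last exact: subsetIl.
  rewrite subsetI der_sub; apply: subset_trans sPhi.
  by rewrite (Phi_joing pD) joing_subl.
by rewrite normsI ?normG ?(subset_trans sMG) ?normal_norm.
Qed.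
End MaximalSupplement.

Lemma cyclic_quotient_cent_prime (gT : finGroupType) (G N : {group gT}) :
  N <| G -> prime #|N| -> cyclic (G / 'C_G(N)).
Proof.
move=> /andP[_ nNG] prN.
have -> : 'C_G(N) = 'ker (restrm nNG (conj_aut N)).
  by rewrite ker_restrm ker_conj_aut.
rewrite (isog_cyclic (first_isog _)) /= im_restrm.
exact: cyclicS (Aut_conj_aut _ _) (Aut_prime_cyclic prN).
Qed.

Section Formation.
Variable F : group_class.
Hypothesis formF : formation F.

Lemma formation_isog (gT rT : finGroupType) (G : {group gT}) (G' : {group rT}) :
  G \isog G' -> F G -> F G'.
Proof. by case: formF => h _ _; apply: h. Qed.

Lemma formation_quotientS (gT : finGroupType) (G N M : {group gT}) :
  N <| G -> M <| G -> N \subset M -> F (G / N)%G -> F (G / M)%G.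
Proof.
move=> nN nM sNM FGN; apply: (formation_isog (third_isog sNM nN nM)).
by case: formF => _ h _; apply: (h _ _ (M / N)%G) FGN; apply: quotient_normal.
Qed.

Lemma formation_quotient_ker (gT rT : finGroupType) (G : {group gT})
    (f : {morphism G >-> rT}) : F (f @* G)%G -> F (G / 'ker f)%G.
Proof. by apply: formation_isog; rewrite isog_sym; apply: first_isog. Qed.

Lemma formation_subdirect (gT : finGroupType) (G N1 N2 N : {group gT}) :
  N1 <| G -> N2 <| G -> N <| G -> N1 :&: N2 \subset N ->
  F (G / N1)%G -> F (G / N2)%G -> F (G / N)%G.
Proof.
move=> n1 n2 n s F1 F2.
apply: (@formation_quotientS _ G (N1 :&: N2)%G N) => //; first exact: normalI.
by case: formF => _ _; apply.
Qed.

Lemma formation_quotient1 (gT : finGroupType) (G N : {group gT}) :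
  N :=: 1 -> F (G / N)%G -> F G.
Proof.
move=> N1; apply: formation_isog; rewrite isog_sym.
by apply: quotient_isog; rewrite N1 ?norms1 ?setI1g // setIC; apply: (setIidPl (sub1G G)).
Qed.

Section Saturated.
Hypothesis satF : saturated F.
Hypothesis superF : forall (rT : finGroupType) (H : {group rT}), supersoluble H -> F H.

Lemma saturated_sub_Phi (gT : finGroupType) (G N : {group gT}) :
  N <| G -> N \subset 'Phi(G) -> F (G / N)%G -> F G.
Proof.
move=> nN sN FGN; apply: satF.
exact: formation_quotientS nN (Phi_normal G) sN FGN.
Qed.

(** If [N] is not Frattini, a maximal [M] complements it and [C = 'C_M(N)] is normal, so [G] is
    subdirect in [G / N] and [G / C]. The latter is supersoluble: [N C / C] is cyclic, and
    [G / (N C) = G / 'C_G(N)] embeds in the cyclic group [Aut N]. *)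
Lemma formation_prime_normal (gT : finGroupType) (G N : {group gT}) :
  N <| G -> prime #|N| -> F (G / N)%G -> F G.
Proof.
move=> nN prN FGN; have [sPhi|nsPhi] := boolP (N \subset 'Phi(G)).
  exact: saturated_sub_Phi sPhi FGN.
have [sNG nNG] := andP nN.
have [M maxM nsNM] := not_sub_Phi sNG nsPhi.
have sMG := proper_sub (maxgroupp maxM).
have defG : M * N = G.
  by rewrite (normC (subset_trans sMG nNG)) (maximal_supplement nN maxM).
have abN : abelian N := cyclic_abelian (prime_cyclic prN).
pose C := 'C_M(N)%G.
have nC : C <| G.
  apply/andP; split; first by rewrite subIset ?sMG.
  rewrite -defG mulG_subG normsI ?normG ?(subset_trans sMG) //=; last first.
    by rewrite (subset_trans nNG) ?cent_norm.
  by apply: cents_norm; rewrite centsC subsetIr.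
have tiNC : N :&: C = 1.
  apply: prime_TIg => //; apply: contra nsNM => sNC.
  exact: subset_trans sNC (subsetIl _ _).
have nCN : N \subset 'N(C) := subset_trans sNG (normal_norm nC).
apply: (@formation_quotient1 _ G 1%G) => //.
apply: (@formation_subdirect _ G N C 1%G) => //; rewrite ?normal1 ?tiNC //.
apply: superF; exists [:: (N / C)%G; (G / C)%G].
split=> //=; last by rewrite !quotient_normal // normal_refl.
rewrite sub1G quotientS // andbT.
have cycNC : cyclic (N / C) by rewrite quotient_cyclic ?prime_cyclic.
rewrite quotient_cyclic //=.
have nCNG : N <*> C <| G by rewrite normalY.
have -> : N / C = (N <*> C) / C by rewrite quotientYidr.
rewrite (isog_cyclic (third_isog (joing_subr N C) nC nCNG)).
rewrite (_ : (N <*> C)%G = 'C_G(N)%G); first exact: cyclic_quotient_cent_prime.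
apply: val_inj; rewrite /= norm_joinEr; last by rewrite (subset_trans (normal_sub nC)).
rewrite /= group_modl //; congr (_ :&: _).
have /comm_group_setP cMN : group_set (M * N) by rewrite defG groupP.
by rewrite -cMN.
Qed.

Lemma hypercyclic_formation (gT : finGroupType) (G E : {group gT}) :
  hypercyclic G E -> F (G / E)%G -> F G.
Proof.
elim=> [|A B hA IH sAB nB prB FGB].
  by apply: formation_quotient1.
apply: IH; have nA := hypercyclic_normal hA.
apply: (@formation_prime_normal _ (G / A)%G (B / A)%G).
- exact: quotient_normal.
- by rewrite card_quotient // (subset_trans (normal_sub nB)) ?normal_norm.
- by apply: formation_isog FGB; rewrite isog_sym; apply: third_isog.
Qed.

End Saturated.
End Formation.

(** * Frobenius' criterion for p-nilpotency *)

Section Frobenius.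
Variable p : nat.

Lemma pnat_index_of_p'elts (gT : finGroupType) (G N : {group gT}) :
  N <| G -> (forall y, y \in G -> p^'.-elt y -> y \in N) -> p.-nat #|G : N|.
Proof.
move=> nN p'N; rewrite -card_quotient ?normal_norm //.
apply/pnatP=> // q q_pr /(Cauchy q_pr)[_ /morphimP[y nNy Gy ->] oq].
apply: contraT => neq_qp.
have p'q : p^'.-elt (coset N y) by rewrite /p_elt oq pnatE // inE.
have : coset N y = 1.
  rewrite -(constt_p_elt p'q) -morph_constt //; apply: coset_id.
  by apply: p'N; rewrite ?p_elt_constt // groupX.
by move/eqP; rewrite -order_eq1 oq => /eqP q1; move: q_pr; rewrite q1.
Qed.

(** Frobenius' condition that ['N_G(Y) / 'C_G(Y)] is a p-group for every p-subgroup [Y], put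
    elementwise so that subgroups inherit it at once. *)
Definition p'normalizers_central (gT : finGroupType) (G : {group gT}) :=
  forall (Y : {group gT}) y, Y \subset G -> p.-group Y ->
    y \in 'N_G(Y) -> p^'.-elt y -> y \in 'C(Y).

Variable gT : finGroupType.
Implicit Types G N P Q S T D : {group gT}.

Lemma p'normalizers_centralS G N : N \subset G ->
  p'normalizers_central G -> p'normalizers_central N.
Proof.
move=> sNG h Y y sY pY /setIP[Ny nY] p'y; apply: (h Y) => //.
  exact: subset_trans sNG.
by apply/setIP; rewrite (subsetP sNG).
Qed.

Lemma norm_cent_Sylow G D S : p'normalizers_central G -> D \subset G ->
  p.-group D -> p.-Sylow('N_G(D)) S -> 'N_G(D) \subset S * 'C_G(D).
Proof.
move=> hG sDG pD sylS.
have nC : 'C_G(D) <| 'N_G(D) by apply: subcent_normal.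
have pI : p.-nat #|'N_G(D) : 'C_G(D)|.
  apply: pnat_index_of_p'elts => // y Ny p'y.
  by rewrite inE (subsetP (subsetIl _ _) _ Ny) (hG D).
have nCS : S \subset 'N('C_G(D)) := subset_trans (pHall_sub sylS) (normal_norm nC).
rewrite normC // -quotientSK ?normal_norm //.
rewrite -card_quotient ?normal_norm // in pI.
have := card_Hall (quotient_pHall nCS sylS); rewrite part_pnat_id //= => e.
have /eqP <- : S / 'C_G(D) == 'N_G(D) / 'C_G(D); last exact: subxx.
by rewrite eqEcard quotientS ?(pHall_sub sylS) //= e.
Qed.

(* Downward induction on the intersection, as in Isaacs, Finite Group Theory, 5.26. *)
Lemma Sylow_conj_cent G P Q : p'normalizers_central G ->
  p.-Sylow(G) P -> p.-Sylow(G) Q ->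
  exists2 c, c \in 'C_G(P :&: Q) & Q :=: P :^ c.
Proof.
move=> hG; move: {2}_.+1 (ltnSn (#|G| - #|P :&: Q|)) => n.
elim: n => // n IH in P Q *; rewrite ltnS => len sylP sylQ.
have [sPG pP _] := and3P sylP; have [sQG pQ _] := and3P sylQ.
set D := (P :&: Q)%G.
have [sDP sDQ] : D \subset P /\ D \subset Q by rewrite subsetIl subsetIr.
have sDG := subset_trans sDP sPG; have pD := pgroupS sDP pP.
have oPQ : #|P| = #|Q| by rewrite (card_Hall sylP) (card_Hall sylQ).
have [eDP|neDP] := eqVneq (D : {set _}) P.
  exists 1; rewrite ?group1 // conjsg1; apply/eqP; rewrite eq_sym eqEcard.
  by rewrite -{1}eDP sDQ oPQ leqnn.
have pDP : D \proper P by rewrite properEneq neDP.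
have pDQ : D \proper Q.
  by rewrite properEcard sDQ -oPQ proper_card.
have pN1 := nilpotent_proper_norm (pgroup_nil pP) pDP.
have pN2 := nilpotent_proper_norm (pgroup_nil pQ) pDQ.
have sN1 : 'N_P(D) \subset 'N_G(D) by rewrite setSI.
have sN2 : 'N_Q(D) \subset 'N_G(D) by rewrite setSI.
have [S sylS sS] := Sylow_superset sN1 (pgroupS (subsetIl _ _) pP).
have [T sylT sT] := Sylow_superset sN2 (pgroupS (subsetIl _ _) pQ).
have [R sylR sSR] := Sylow_superset (subset_trans (pHall_sub sylS) (subsetIl _ _)) (pHall_pgroup sylS).
have lt D' : D \proper D' -> D' \subset G -> #|G| - #|D'| < n.
  move=> pD' sD'G; apply: leq_trans len; apply: ltn_sub2l (proper_card pD').
  exact: leq_trans (proper_card pD') (subset_leq_card sD'G).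
have sDint D' D1 : D \proper 'N_D1(D) -> 'N_D1(D) \subset D' -> D \proper D1 :&: D'.
  by move=> h1 h2; apply: proper_sub_trans h1 _; rewrite subsetI subsetIl.
have [a Ca eR] : exists2 c, c \in 'C_G(P :&: R) & R :=: P :^ c.
  apply: IH => //; apply: lt; last by rewrite subIset // sPG.
  by apply: sDint => //; apply: subset_trans sS sSR.
(* Since ['N_G(D) = S 'C_G(D)], the element taking [S] to [T] can be chosen centralising [D]. The
   conjugations from [P] to [R], to [R :^ c], to [Q] then all centralise [D]. *)
have [m Nm eT] := Sylow_trans sylS sylT.
have [s c Ss Cc em] := mulsgP (subsetP (norm_cent_Sylow hG sDG pD sylS) m Nm).
have {}eT : T :=: S :^ c by rewrite eT em conjsgM (conjGid Ss).
have Gc : c \in G by case/setIP: Cc.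
have sylRc : p.-Sylow(G) (R :^ c)%G by rewrite pHallJ.
have [b Cb eQ] : exists2 d, d \in 'C_G((R :^ c)%G :&: Q) & Q :=: (R :^ c)%G :^ d.
  apply: IH => //; rewrite setIC; apply: lt; last by rewrite subIset // sQG.
  by apply: sDint => //; apply: subset_trans sT _; rewrite eT conjSg.
have subC D' e : D \subset D' -> e \in 'C_G(D') -> e \in 'C_G(D).
  by move=> sD; apply: subsetP; rewrite setIS ?centS.
exists (a * c * b); last by rewrite !conjsgM -eR.
rewrite !groupM //.
  apply: subC Ca; rewrite subsetI sDP.
  by apply: subset_trans sSR; apply: subset_trans (proper_sub pN1) sS.
apply: subC Cb; rewrite subsetI sDQ andbT /=.
apply: subset_trans (proper_sub pN2) (subset_trans sT _).
by rewrite eT conjSg.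
Qed.

(** As [x] lies in [P] and in [P :^ g^-1], some [c] centralising [x] satisfies [P :^ g^-1 = P :^ c].
    Then [c g] normalises [P] and acts on [x] as [g]; now use ['N_G(P) = P 'C_G(P)]. *)
Lemma Sylow_fusion G P x g : p'normalizers_central G -> p.-Sylow(G) P ->
  x \in P -> g \in G -> x ^ g \in P -> exists2 u, u \in P & x ^ g = x ^ u.
Proof.
move=> hG sylP Px Gg Pxg; have [sPG pP _] := and3P sylP.
have sylQ : p.-Sylow(G) (P :^ g^-1)%G by rewrite pHallJ ?groupV.
have [c /setIP[Gc Cc] eQ] := Sylow_conj_cent hG sylP sylQ.
have cxc : x ^ c = x.
  apply/conjg_fixP/commgP/commute_sym/(centP Cc).
  by rewrite inE Px mem_conjg invgK.
have Ncg : c * g \in 'N_G(P).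
  by rewrite !inE groupM //= conjsgM -eQ conjsgKV.
have NP : p.-Sylow('N_G(P)) P.
  by apply: pHall_subl sylP; rewrite ?normsG ?subsetI ?sPG ?normG ?subsetIl.
have [u d Pu /setIP[_ Cd] e] := mulsgP (subsetP (norm_cent_Sylow hG sPG pP NP) _ Ncg).
exists u => //; rewrite -{1}cxc -conjgM e conjgM.
apply/conjg_fixP/commgP/commute_sym/(centP Cd).
by rewrite memJ_norm // (subsetP (normG P)).
Qed.
End Frobenius.

(** * Transfer into the abelianisation of a Sylow subgroup *)

Import FiniteModule.

Definition derived_coset (gT : finGroupType) (P : {group gT}) :
  {morphism P >-> coset_of P^`(1)} :=
  restrm_morphism (der_norm 1 P) (coset_morphism P^`(1)).

Lemma transfer_abelian (gT : finGroupType) (P : {group gT}) :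
  abelian (derived_coset P @* P).
Proof. by rewrite morphim_restrm setIid; apply: (der_abelian 0). Qed.

Section TransferKernel.
Variables (gT : finGroupType) (p : nat) (G P : {group gT}).
Hypotheses (hG : p'normalizers_central p G) (sylP : p.-Sylow(G) P).

Let sPG : P \subset G := pHall_sub sylP.
Local Notation al := (derived_coset P).
Local Notation abP := (transfer_abelian P).

Local Notation V := (@transfer_morphism _ _ G P al abP).

(* Each factor of the transfer is G-conjugate, hence P-conjugate, to a power of x. *)
Lemma transfer_fusion x : x \in P -> fmval (V x) = al x ^+ #|G : P|.
Proof.
move=> Px; have Gx := subsetP sPG x Px.
have trX := transversalP (rcosets_cycle_partition sPG Gx).
have /= -> := transfer_cycle_expansion sPG abP Gx trX.
rewrite -(sum_index_rcosets_cycle sPG Gx trX) fmval_sum (big_morph _ (expgD (al x)) (expg0 _)) /=.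
apply: eq_bigr => y Xy; set n := #|_ : _|.
have Gy : y \in G := subsetP (transversal_sub trX) y Xy.
have Pn : (x ^+ n) ^ y^-1 \in P.
  have := mulg_exp_card_rcosets P x y.
  by rewrite mem_rcoset conjgE invgK mulgA.
have [u Pu ->] := Sylow_fusion hG sylP (groupX n Px) (groupVr Gy) Pn.
have Am : al ((x ^+ n) ^ u) \in al @* P by rewrite mem_morphim // groupJ // groupX.
apply: etrans (fmodK abP Am) _; rewrite morphJ ?groupX // morphX //.
apply/conjg_fixP/commgP; apply: (centsP abP); last by rewrite mem_morphim.
by rewrite groupX // mem_morphim.
Qed.

Lemma transfer_kernel_index : p.-nat #|G : 'ker V|.
Proof.
apply: pnat_index_of_p'elts => //; first exact: ker_normal.
move=> y Gy p'y; apply/kerP => //; apply: fmod_inj.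
set w := fmval _; have Aw : w \in al @* P by apply: fmodP.
have pw : p.-elt w.
  by apply: mem_p_elt Aw; rewrite morphim_pgroup // (pHall_pgroup sylP).
have p'w : p^'.-elt w.
  rewrite /p_elt; apply: pnat_dvd p'y; rewrite order_dvdn.
  by rewrite -morphX ?inE // -morphX // expg_order !morph1.
by rewrite /= -[w](constt_p_elt pw) (constt1P p'w).
Qed.

(** On the kernel, the p-element [al x] would have order dividing [|G : P|], which is prime to [p];
    so [P] would equal its derived subgroup. *)
Lemma transfer_kernel_proper : P :!=: 1 -> ~~ (P \subset 'ker V).
Proof.
move=> ntP; apply/negP => sPK.
have pP := pHall_pgroup sylP.
have /proper_subn/negP := sol_der1_proper (pgroup_sol pP) (subxx P) ntP.
apply; apply/subsetP=> x Px.
have /kerP := subsetP sPK x Px; rewrite (subsetP sPG) // => /(_ isT) e.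
have alx : al x ^+ #|G : P| = 1 by rewrite -transfer_fusion // e.
have Nx : x \in 'N(P^`(1)) := subsetP (der_norm 1 P) x Px.
apply: coset_idr => //; rewrite -[coset _ x]/(al x).
have pal : p.-elt (al x).
  by apply: morph_p_elt; rewrite // (mem_p_elt pP).
rewrite -(constt_p_elt pal); apply/constt1P.
rewrite /p_elt; apply: pnat_dvd (_ : p^'.-nat #|G : P|); first by rewrite order_dvdn alx.
by case/and3P: sylP.
Qed.
End TransferKernel.

(** The transfer kernel [N] is a proper normal subgroup of p-power index. By induction ['O_p^'(N)]
    has p-power index in [N], and it lies in ['O_p^'(G)]. *)
Theorem p'normalizers_central_pcore (gT : finGroupType) (p : nat) (G : {group gT}) :
  prime p -> p'normalizers_central p G -> p.-nat #|G : 'O_p^'(G)|.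
Proof.
move=> p_pr; move: {2}_.+1 (ltnSn #|G|) => n; elim: n => // n IH in G *.
rewrite ltnS => len hG; have [P sylP] := Sylow_exists p G.
have [P1|ntP] := eqVneq (P : {set gT}) 1.
  rewrite pcore_pgroup_id ?indexgg //.
  by rewrite /pgroup -partn_eq1 // -(card_Hall sylP) P1 cards1.
have [N [nN pN psN]] : exists N : {group gT}, [/\ N <| G, p.-nat #|G : N| & ~~ (P \subset N)].
  exists ('ker (transfer_morphism G (transfer_abelian P)))%G; split.
  - exact: ker_normal.
  - exact: transfer_kernel_index sylP.
  - exact: transfer_kernel_proper hG sylP ntP.
have sNG := normal_sub nN.
have pNG : N \proper G.
  by rewrite properE sNG; apply: contra psN; apply: subset_trans (pHall_sub sylP).
have {IH}:= IH N (leq_trans (proper_card pNG) len) (p'normalizers_centralS sNG hG).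
move=> pNO; apply: (@pnat_dvd _ #|G : 'O_p^'(N)|).
  apply: indexgS; apply: pcore_max (pcore_pgroup _ _) _.
  exact: char_normal_trans (pcore_char _ _) nN.
by rewrite -(Lagrange_index sNG (pcore_sub _ _)) pnatM pN.
Qed.

(** * Normal p-subgroups with a largest proper invariant subgroup *)

Section Core.
Variables (gT : finGroupType) (p : nat) (G D L : {group gT}).
Hypotheses (pD : p.-group D) (nDG : D <| G) (nLG : L <| G) (pLD : L \proper D).
Hypothesis chL : forall N : {group gT}, N <| G -> N \subset D -> N :=: D \/ N \subset L.

Lemma unique_max_normal_der : D^`(1) \subset L.
Proof.
have ntD : D :!=: 1 by apply: contraTneq pLD => ->; rewrite properE sub1G andbF.
have [e|//] := chL (gFnormal_trans _ nDG) (der_sub 1 D).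
by have := sol_der1_proper (pgroup_sol pD) (subxx D) ntD; rewrite e properxx.
Qed.

Lemma unique_max_normal_Phi : 'Phi(D) \subset L.
Proof.
have ntD : D :!=: 1 by apply: contraTneq pLD => ->; rewrite properE sub1G andbF.
have [e|//] := chL (gFnormal_trans _ nDG) (Phi_sub D).
by have := Phi_proper ntD; rewrite e properxx.
Qed.

Lemma unique_max_normal_expgn x : x \in D -> x ^+ p \in L.
Proof.
move=> Dx; have [x1|ntx] := eqVneq x 1; first by rewrite x1 expg1n group1.
have p_pr : prime p by case: (pgroup_pdiv pD) => //; apply: contraNneq ntx => D1; move: Dx; rewrite D1 => /set1gP->.
apply: (subsetP unique_max_normal_Phi); rewrite (Phi_joing pD).
apply: (subsetP (joing_subr _ _)).
by rewrite -[p in x ^+ p]expn1; apply: Mho_p_elt => //; apply: mem_p_elt pD Dx.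
Qed.

Lemma unique_max_normal_minnormal : minnormal (D / L) (G / L).
Proof.
have [sDG nD] := andP nDG; have [_ nL] := andP nLG.
apply/mingroupP; split=> [|N /andP[ntN nN] sN].
  rewrite quotient_norms // andbT -subG1 quotient_sub1 ?(subset_trans sDG nL) //.
  exact: proper_subn.
have nNG : coset L @*^-1 N <| G.
  rewrite -(quotientGK nLG) cosetpre_normal /normal nN andbT.
  by rewrite (subset_trans sN) ?quotientS.
have sND : coset L @*^-1 N \subset D.
  by rewrite sub_cosetpre_quo // /normal (proper_sub pLD) (subset_trans sDG).
have [e|] := chL nNG sND; first by rewrite /= -e cosetpreK.
by rewrite sub_cosetpre_quo ?normal_refl // trivg_quotient subG1 (negPf ntN).
Qed.

Lemma unique_max_normal_prime x : x \in D -> D \subset <[x]> <*> L -> prime #|D : L|.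
Proof.
move=> Dx sD; have [sDG nD] := andP nDG; have [_ nL] := andP nLG.
have nLD := subset_trans sDG nL; have nLx := subsetP nLD x Dx.
rewrite -card_quotient //; apply: cyclic_minnormal_prime unique_max_normal_minnormal _.
apply: cyclicS (_ : D / L \subset <[x]> / L) _; last by rewrite quotient_cyclic ?cycle_cyclic.
by rewrite -(@quotientYidr _ L <[x]>) ?cycle_subG // quotientS.
Qed.

Variables (tau : sfunctor) (N : {group gT}).
Hypotheses (tauF : subgroup_functor tau) (tauI : inductive tau).
Hypothesis tameD : forall x, x \in D -> tame tau G <[x]>%G.
Hypotheses (nNG : N <| G) (capN : N :&: D = L).
Hypothesis regN : forall H : {group coset_of N}, p.-group H -> tau (G / N)%G H ->
  H \subset D / N -> p.-nat #|G / N : 'N_(G / N)(H)|.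

(** The quotient is by [N], which may exceed [L]: quasiregularity supplies [regN] for [N = L],
    whereas its primitive version supplies it when [N] is the core of a maximal subgroup. *)
Lemma tame_chief_prime : prime #|D : L|.
Proof.
have [sDG nD] := andP nDG; have [sLG nL] := andP nLG.
have [Q sylQ sDQ] := Sylow_superset sDG pD.
have [sQG pQ _] := and3P sylQ; have nLQ := subset_trans sQG nL.
have sLD := proper_sub pLD; have nLD := subset_trans sDG nL.
have [y] : exists y, y \in ((D / L) :&: 'Z(Q / L))^#.
  apply/set0Pn; rewrite setD_eq0 subG1; apply: meet_center_nil.
  - exact: pgroup_nil (quotient_pgroup L pQ).
  - by apply: quotient_normal; apply: normalS nDG.
  by rewrite -subG1 quotient_sub1 ?proper_subn.
case/setD1P=> nty /setIP[/morphimP[x nLx Dx ey] /setIP[_ cQx]].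
rewrite ey in nty cQx.
have nsxL : x \notin L by apply: contraNN nty => Lx; apply/eqP; apply: coset_id.
have cxQ g : g \in Q -> [~ x, g] \in L.
  move=> Qg; apply: coset_idr; first by rewrite groupR // (subsetP nLQ g Qg).
  rewrite morphR ?(subsetP nLQ g Qg) //; apply/eqP/commgP/(centP cQx).
  exact: mem_quotient.
have pr := unique_max_normal_prime Dx.
have sxD : <[x]> \subset D by rewrite cycle_subG.
have sxG := subset_trans sxD sDG.
have defD : (exists2 B : {group gT}, B \subset L & <[x]> * B = D) -> prime #|D : L|.
  case=> B sB eD; apply: pr; rewrite -eD mul_subG ?joing_subl //.
  exact: subset_trans sB (joing_subr _ _).
case: (tameD Dx) => [[T pT HT]|[Z hZ sZ]|tH].
(* Enlarge the supplement to a maximal [M]. Then [D :&: M] is normal and proper in [D], so it lies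
   in [L], and [D = <[x]> (D :&: M)]. *)
- have [|[M maxM sTM]] := maximal_exists (proper_sub pT).
    by move=> e; rewrite e properxx in pT.
  have nsDM : ~~ (D \subset M).
    apply/negP=> sDM; case/andP: (maxgroupp maxM) => _ /negP; apply.
    by rewrite -HT mul_subG // (subset_trans sxD).
  have nDM := maximal_cap_normal nDG pD maxM nsDM.
  apply: defD; exists (D :&: M)%G.
    have [e|//] := chL nDM (subsetIl _ _).
    by case/negP: nsDM; rewrite -e subsetIr.
  rewrite /= setIC group_modl //; apply/setIidPr.
  by rewrite (subset_trans sDG) // -HT mulgS.
- apply: (hypercyclic_chief hZ nDG nLG pLD).
    have nZD : Z :&: D <| G by rewrite normalI ?(hypercyclic_normal hZ).
    have [/setIidPr //|] := chL nZD (subsetIr _ _).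
    have Zx : x \in Z by apply: (subsetP sZ); apply: cycle_id.
    by move/subsetP/(_ x); rewrite inE Dx Zx (negPf nsxL) => /(_ isT).
  move=> B nB sLB sBD; case: (chL nB sBD) => [|sBL]; [by right | left].
  by apply/eqP; rewrite eqEsubset sBL.
have nc := gcore_normal sxG.
have sc : gcore <[x]> G \subset D := subset_trans (gcore_sub _ _) sxD.
have [e|scL] := chL nc sc.
  by apply: pr; rewrite -e (subset_trans (gcore_sub _ _)) ?joing_subl.
have sLN : L \subset N by rewrite -capN subsetIl.
have [_ nN] := andP nNG.
have tN := tau_quotient tauF tauI nc nNG (subset_trans scL sLN) sxG tH.
have px : p.-group <[x]> := pgroupS sxD pD.
have pI := regN (quotient_pgroup N px) tN (quotientS _ sxD).
have nNx : x \in 'N(N) := subsetP (subset_trans sDG nN) x Dx.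
(* A Sylow p-subgroup centralises [x] modulo [N], so the normaliser of [<[x]> / N] has index prime
   to [p]; by [regN] the index is also a power of [p]. *)
have sQN : Q / N \subset 'N_(G / N)(<[x]> / N).
  rewrite subsetI quotientS //= cents_norm // quotient_cycle // cent_cycle.
  apply/subsetP=> _ /morphimP[g nNg Qg ->]; apply/cent1P/commute_sym/commgP/eqP.
  by rewrite -morphR //; apply/coset_id/(subsetP sLN)/cxQ.
have [_ _ p'Q] := and3P (quotient_pHall (subset_trans sQG nN) sylQ).
have nxN : G / N \subset 'N(<[x]> / N).
  have := pnat_1 pI (pnat_dvd (indexgS _ sQN) p'Q).
  by move/eqP; rewrite indexg_eq1 subsetI => /andP[].
have nB : coset N @*^-1 (<[x]> / N) <| G.
  by rewrite -(quotientGK nNG) cosetpre_normal /normal quotientS.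
(* By the modular law [<[x]> L] is the intersection of [D] with the normal subgroup [<[x]> N]. It
   contains [x], which is not in [L], so it is all of [D]. *)
apply: defD; exists L => //; rewrite -capN group_modl //.
have nBD : coset N @*^-1 (<[x]> / N) :&: D <| G by rewrite normalI.
have eB : coset N @*^-1 (<[x]> / N) = <[x]> * N.
  by rewrite quotientK ?cycle_subG //; apply/esym/normC; rewrite cycle_subG.
have [|sBL] := chL nBD (subsetIr _ _); first by rewrite /= eB.
case/negP: nsxL; apply: (subsetP sBL); rewrite inE Dx andbT.
by rewrite /= eB; apply/mulsgP; exists x 1; rewrite ?cycle_id ?mulg1 ?group1.
Qed.
End Core.

(* The exponent forced on a p-group D = [D, A] when A centralises a central
   subgroup L containing D^`(1) and all p-th powers. *)
Definition crit_exp (gT : finGroupType) (p : nat) (D : {group gT}) : nat :=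
  if (p == 2) && ~~ abelian D then 4 else p.

Section CriticalExponent.
Variables (gT : finGroupType) (p : nat) (D L : {group gT}).
Hypotheses (p_pr : prime p) (pD : p.-group D).
Hypotheses (sD'L : D^`(1) \subset L) (sLZ : L \subset 'Z(D)).
Hypothesis DpL : forall x, x \in D -> x ^+ p \in L.
Local Notation e := (crit_exp p D).

(** In class at most 2 the error term is [[~ y, x]] to the power ['C(e, 2)], and [[~ y, x] ^+ p = 1]
    since [x ^+ p] is central. An odd [p] divides ['C(p, 2)], and ['C(4, 2) = 6] is even. *)
Lemma crit_expM : {in D &, {morph (fun x => x ^+ e) : x y / x * y}}.
Proof.
move=> x y Dx Dy /=.
have Rc u z : u \in L -> z \in D -> commute z u.
  by move=> /(subsetP sLZ)/setIP[_ /centP c] /c/commute_sym.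
have LR : [~ y, x] \in L by apply: (subsetP sD'L); rewrite mem_commg.
have Rp : [~ y, x] ^+ p = 1.
  rewrite -commXg; last exact: Rc.
  by apply/eqP/commgP/commute_sym/Rc; rewrite ?DpL.
rewrite expMg_Rmul; try by apply: Rc => //; rewrite -invg_comm groupV.
suff -> : [~ y, x] ^+ 'C(e, 2) = 1 by rewrite mulg1.
rewrite /crit_exp; case: (eqVneq p 2) Rp => [-> /= R2|np2 Rp] /=.
  case: (boolP (abelian D)) => [/centsP ab|_] /=; last by rewrite (expgM _ 2 3) R2 expg1n.
  by rewrite expg1; apply/eqP/commgP/ab.
have /dvdnP[k ->] : p %| 'C(p, 2).
  by rewrite prime_dvd_bin //= ltn_neqAle eq_sym np2 prime_gt1.
by rewrite mulnC expgM Rp expg1n.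
Qed.

Lemma crit_exp_mem x : x \in D -> x ^+ e \in L.
Proof.
move=> Dx; rewrite /crit_exp; case: eqP => [p2|_] /=; last exact: DpL.
case: ifP => _; last exact: DpL.
by rewrite (expgM x 2 2) groupX // -p2 DpL.
Qed.

Canonical crit_morphism := Morphism crit_expM.

(** The power map sends [D] into [L], where [A] acts trivially, so it takes equal values at [x] and
    [x ^ a] and kills the generators of [[~: D, A]]. *)
Lemma crit_exp_ker (A : {group gT}) : A \subset 'N(D) -> A \subset 'C(L) -> [~: D, A] = D ->
  forall x, x \in D -> x ^+ e = 1.
Proof.
move=> nDA cLA defD.
have : D \subset 'ker crit_morphism.
  rewrite -{1}defD gen_subG; apply/subsetP=> _ /imset2P[x a Dx Aa ->].
  have Dxa : x ^ a \in D by rewrite memJ_norm // (subsetP nDA).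
  rewrite commgEl; apply/kerP; first by rewrite groupM ?groupV.
  rewrite morphM ?groupV // morphV //=.
  have /commgP/conjg_fixP : commute (x ^+ e) a.
    by apply/commute_sym/(centP (subsetP cLA a Aa)); apply: crit_exp_mem.
  by rewrite conjXg => ->; rewrite mulVg.
by move=> sDk x Dx; apply: (mker (subsetP sDk x Dx)).
Qed.

End CriticalExponent.

Lemma crit_exp_order (gT : finGroupType) (p : nat) (D : {group gT}) (x : gT) :
  prime p -> x ^+ crit_exp p D = 1 ->
  [\/ x = 1, prime #[x] | [/\ p = 2, ~~ abelian D & #[x] = 4]].
Proof.
move=> p_pr /eqP; rewrite -order_dvdn /crit_exp.
have prime_case : #[x] %| p -> [\/ x = 1, prime #[x] | [/\ p = 2, ~~ abelian D & #[x] = 4]].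
  case/(dvdn_prime_or1 p_pr) => [/eqP|]; last by constructor 2.
  by rewrite order_eq1 => /eqP; constructor 1.
case: eqP => [p2|//] /=; case: ifP => ab; last by rewrite -ab.
rewrite dvdn_divisors // !inE order_eq1.
by case/or3P=> /eqP e; [constructor 1 | constructor 2; rewrite e | constructor 3].
Qed.

Definition tame_elements (tau : sfunctor) (p : nat) (gT : finGroupType) (G P : {group gT}) :=
  forall x, x \in P -> (prime #[x] -> tame tau G <[x]>%G) /\
    (p = 2 -> ~~ abelian P -> #[x] = 4 -> tame tau G <[x]>%G).

Lemma tame_crit (tau : sfunctor) (p : nat) (gT : finGroupType) (G P D : {group gT}) (x : gT) :
  prime p -> tame_elements tau p G P -> D \subset P -> x \in D -> x ^+ crit_exp p D = 1 ->
  tame tau G <[x]>%G.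
Proof.
move=> p_pr tP sDP Dx xe; have [t1 t2] := tP x (subsetP sDP x Dx).
case: (crit_exp_order p_pr xe) => [x1|/t1 //|[p2 nab o4]]; last first.
  by apply: t2 => //; apply: contra nab; apply: abelianS.
constructor 2; exists 1%G; first by constructor.
by rewrite x1 /= cycle1.
Qed.

Lemma tame_elementsS (tau : sfunctor) (p : nat) (gT : finGroupType) (G P D : {group gT}) :
  tame_elements tau p G P -> D \subset P -> tame_elements tau p G D.
Proof.
move=> tP sDP x Dx; have [t1 t2] := tP x (subsetP sDP x Dx); split=> // p2 nab.
by apply: t2 => //; apply: contra nab; apply: abelianS.
Qed.

Lemma centralizer_of_commg (gT : finGroupType) (D L A : {group gT}) :
  D \subset 'N(L) -> A \subset 'C(L) -> [~: D, A] = D -> L \subset 'C(D).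
Proof.
move=> nLD cLA defD; apply/commG1P; rewrite commGC -{1}defD.
apply: three_subgroup; last first.
  apply/commG1P; apply: subset_trans (_ : L \subset _); last by rewrite centsC.
  by rewrite commg_subl.
by rewrite (commG1P cLA) comm1G.
Qed.

(** Take [D] minimal among the [A]-invariant subgroups of [Y] not centralised by [A], and [L] the
    core of ['C_D(A)] in [D <*> A]. A proper invariant subgroup of [D] is centralised by [A], hence
    lies in [L]. *)
Lemma minimal_noncentral_action (gT : finGroupType) (p : nat) (Y A : {group gT}) :
  prime p -> p.-group Y -> p^'.-group A -> A \subset 'N(Y) -> ~~ (A \subset 'C(Y)) ->
  exists D L : {group gT},
    [/\ D \subset Y, A \subset 'N(D), L <| D <*> A & L \proper D] /\
    [/\ forall N : {group gT}, N <| D <*> A -> N \subset D -> N :=: D \/ N \subset L,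
        A \subset 'C(L), [~: D, A] = D & forall x, x \in D -> x ^+ crit_exp p D = 1].
Proof.
move=> p_pr pY p'A nYA ncYA.
have [|D minD sDY] := @mingroup_exists _ (fun D : {group gT} => (A \subset 'N(D)) && ~~ (A \subset 'C(D))) Y.
  by rewrite nYA.
have {minD} [/andP[nDA ncDA] minD] := mingroupP minD.
have pD := pgroupS sDY pY.
have coDA : coprime #|D| #|A| := pnat_coprime pD p'A.
have defD : [~: D, A] = D.
  apply: (minD [~: D, A]%G); last by rewrite commg_subl.
  (* Coprime action lifts fixed points of [D / [~: D, A]], where [A] acts trivially. If [A] also
     centralised [[~: D, A]], it would centralise [D]. *)
  rewrite commg_normr /=; apply: contra ncDA => cA.
  have sRD : [~: D, A] \subset D by rewrite commg_subl.
  have nRD : D \subset 'N([~: D, A]) by rewrite commg_norml.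
  have := coprime_quotient_cent sRD (commg_normr _ _) coDA (pgroup_sol pD).
  have sC : D / [~: D, A] \subset 'C(A / [~: D, A]) by rewrite quotient_cents2r.
  rewrite (setIidPl sC).
  move/quotient_inj; rewrite /normal subsetI !sRD !subIset ?nRD //= centsC cA.
  by move=> /(_ isT isT)/setIidPl; rewrite centsC.
pose M := (D <*> A)%G; pose L := (gcore_group 'C_D(A) M).
have nDM : D <| M by rewrite /normal joing_subl join_subG normG.
have sLC : L \subset 'C_D(A) := gcore_sub _ _.
have sLD : L \subset D := subset_trans sLC (subsetIl _ _).
have cLA : A \subset 'C(L) by rewrite centsC (subset_trans sLC) ?subsetIr.
have nLM : L <| M.
  by rewrite /normal gcore_norm andbT (subset_trans sLD) ?joing_subl.
have pLD : L \proper D.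
  rewrite properEneq sLD andbT; apply: contraNneq ncDA => e.
  by rewrite -(_ : L :=: D).
have chL : forall N : {group gT}, N <| M -> N \subset D -> N :=: D \/ N \subset L.
  move=> N nNM sND; have nNA : A \subset 'N(N).
    by apply: subset_trans (normal_norm nNM); apply: joing_subr.
  have [cNA|ncNA] := boolP (A \subset 'C(N)); last by left; apply: minD; rewrite ?nNA.
  by right; rewrite sub_gcore ?normal_norm // subsetI sND centsC.
exists D, L; split; split => //.
have sLZ : L \subset 'Z(D).
  rewrite subsetI sLD; apply: centralizer_of_commg cLA defD.
  by apply: subset_trans (normal_norm nLM); apply: joing_subl.
apply: crit_exp_ker nDA cLA defD => //.
  exact: (unique_max_normal_der pD nDM pLD chL).
exact: (unique_max_normal_expgn pD nDM pLD chL).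
Qed.

(** [A] acts on [D / L], of order [p], through an automorphism group of order [p.-1], and this is
    prime to [|A|]. *)
Lemma coprime_act_prime (gT : finGroupType) (p : nat) (D L A : {group gT}) :
  p.-group D -> L <| D <*> A -> A \subset 'N(D) -> L \subset D -> prime #|D : L| ->
  coprime #|A| p.-1 -> [~: D, A] \subset L.
Proof.
move=> pD nLM nDA sLD prDL co.
have [sDM sAM] : D \subset D <*> A /\ A \subset D <*> A by rewrite joing_subl joing_subr.
have [nLD nLA] := (subset_trans sDM (normal_norm nLM), subset_trans sAM (normal_norm nLM)).
rewrite -quotient_cents2 // centsC.
have oDL : #|D / L| = p.
  have := quotient_pgroup L pD; rewrite /pgroup card_quotient //.
  by rewrite pnatE // => /eqP.
have nDLA : A / L \subset 'N(D / L) by rewrite quotient_norms.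
have i1 : #|A / L : 'C_(A / L)(D / L)| = 1%N.
  have -> : #|A / L : 'C_(A / L)(D / L)| = #|conj_aut (D / L) @* (A / L)|.
    by rewrite card_morphim ker_conj_aut (setIidPr nDLA) indexgI.
  have sAut := Aut_conj_aut (D / L)%G (A / L).
  apply/eqP; rewrite -dvdn1 -(eqP co) dvdn_gcd; apply/andP; split.
    by apply: dvdn_trans (dvdn_morphim _ _) (dvdn_morphim _ _).
  have p_pr : prime p by rewrite -oDL card_quotient.
  apply: dvdn_trans (cardSg sAut) _.
  by rewrite card_Aut_cyclic ?prime_cyclic ?oDL // totient_prime.
by have /eqP := i1; rewrite indexg_eq1 subsetI => /andP[].
Qed.

(** * Minimal non-hypercyclic normal subgroups *)

Section CriticalNormal.
Variables (gT : finGroupType) (G : {group gT}).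
Implicit Types A B E K L N : {group gT}.

Lemma hypercyclic_min_ind E : E <| G ->
  (forall K, K <| G -> K \subset E ->
     (forall N, N <| G -> N \proper K -> hypercyclic G N) -> hypercyclic G K) ->
  hypercyclic G E.
Proof.
move: {2}_.+1 (ltnSn #|E|) => n; elim: n => // n IH in E *.
rewrite ltnS => len nE h; apply: (h E) => // N nN pN; apply: IH => //.
  exact: leq_trans (proper_card pN) len.
by move=> K nK sK; apply: (h K) => //; apply: subset_trans sK (proper_sub pN).
Qed.

(** [L] is a maximal proper invariant subgroup. Another one outside [L] would make [K] a join of two
    hypercyclic subgroups, and a prime index would extend the chain of [L]. *)
Lemma min_nonhypercyclic K : K <| G ->
  (forall N, N <| G -> N \proper K -> hypercyclic G N) ->
  hypercyclic G K \/ exists L, [/\ L <| G, L \proper K, hypercyclic G L, ~~ prime #|K : L| &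
    forall N, N <| G -> N \subset K -> N :=: K \/ N \subset L].
Proof.
move=> nK hK; have [K1|ntK] := eqVneq K 1%G; first by left; rewrite K1; constructor.
have [L maxL _] : {L : {group gT} | maxnormal L K G & 1%G \subset L}.
  apply: maxgroup_exists; rewrite norms1 andbT properE sub1G /=.
  by apply: contra ntK => /trivgP e; apply/eqP/val_inj.
have /andP[pL nL] := maxgroupp maxL; have sL := proper_sub pL.
have nLG : L <| G by rewrite /normal nL (subset_trans sL) ?normal_sub.
have hL := hK L nLG pL.
have [pr|npr] := boolP (prime #|K : L|); first by left; apply: HypercyclicS hL sL nK pr.
have [/existsP[N /and3P[nN pN nsN]]|/existsPn noN] :=
  boolP [exists N : {group gT}, [&& N <| G, N \proper K & ~~ (N \subset L)]].
  left; have hNL := hypercyclicY (hK N nN pN) hL.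
  suff -> : K = (N <*> L)%G by [].
  apply/val_inj/eqP; apply: contraR nsN => ne.
  rewrite (subset_trans (joing_subl N L)) //.
  have [_ max] := maxgroupP maxL.
  rewrite (max (N <*> L)%G) ?joing_subr //.
  rewrite properEneq eq_sym ne join_subG (proper_sub pN) sL /=.
  by rewrite normsY ?normal_norm.
right; exists L; split=> // N nN sN; have := noN N; rewrite nN /= negb_and negbK.
case/orP=> [|]; last by right.
by rewrite properEneq sN andbT negbK => /eqP; left.
Qed.

(** [G] acts on [B / A] through the abelian automorphism group of a group of prime order. *)
Lemma der1_stable_prime A B : A <| G -> B <| G -> A \subset B -> prime #|B : A| ->
  [~: B, G^`(1)] \subset A.
Proof.
move=> nA nB sAB pr; have [_ nAG] := andP nA.
have nAB := subset_trans (normal_sub nB) nAG.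
have nBA : B / A <| G / A by rewrite quotient_normal.
have cyc := cyclic_quotient_cent_prime nBA; rewrite card_quotient // in cyc.
rewrite -quotient_cents2 ?(subset_trans (der_sub 1 G)) // quotient_der // centsC.
apply: subset_trans (der1_min _ (cyclic_abelian (cyc pr))) (subsetIr _ _).
by rewrite normsI ?normG // (subset_trans (normal_norm nBA)) ?cent_norm.
Qed.
End CriticalNormal.

Lemma minnormal_central_prime (gT : finGroupType) (G N : {group gT}) :
  minnormal N G -> N \subset 'C(G) -> prime #|N|.
Proof.
move=> minN cN; apply: (cyclic_minnormal_prime minN).
have /mingroupP[/andP[ntN _] min] := minN.
have [x Nx ntx] := trivgPn _ ntN.
rewrite -(min <[x]>%G) ?cycle_cyclic ?cycle_subG //= cycle_eq1 ntx /=.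
by rewrite cents_norm // centsC cycle_subG (subsetP cN).
Qed.

Section CriticalTheory.
Variables (gT : finGroupType) (G K L : {group gT}).
Hypotheses (nK : K <| G) (nL : L <| G) (pL : L \proper K) (hL : hypercyclic G L).
Hypotheses (npr : ~~ prime #|K : L|).
Hypothesis chL : forall N : {group gT}, N <| G -> N \subset K -> N :=: K \/ N \subset L.
Implicit Types A B N : {group gT}.

Let sLK := proper_sub pL.

(** Otherwise [[~: K, G]] lies in [L]; then [K / L] is central and minimal normal, hence of prime
    order. *)
Lemma critical_sub_der1 : K \subset G^`(1).
Proof.
have nKG' : K :&: G^`(1) <| G by rewrite normalI ?der_normal.
have [/setIidPl //|sL] := chL nKG' (subsetIl _ _).
case/negP: npr.
have nLK : K \subset 'N(L) := subset_trans (normal_sub nK) (normal_norm nL).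
rewrite -card_quotient //; apply: minnormal_central_prime.
  exact: (unique_max_normal_minnormal nK nL pL chL).
apply: quotient_cents2r; apply: subset_trans sL.
rewrite subsetI commg_subl normal_norm //=.
by rewrite commSg ?normal_sub.
Qed.

Lemma critical_stable A B : A <| G -> B <| G -> A \subset B -> prime #|B : A| ->
  [~: B, K] \subset A.
Proof.
move=> nA nB sAB pr; apply: subset_trans (der1_stable_prime nA nB sAB pr).
exact: commgS critical_sub_der1.
Qed.

(** [K] centralises every step of the chain of [L], so [L] lies in some term of the upper central
    series of [K]; the abelian [K / L] adds one more term. *)
Lemma critical_nilpotent : K^`(1) \subset L -> nilpotent K.
Proof.
move=> sK'L.
have [n sLn] : exists n, L \subset 'Z_n(K).
  suff stab B : hypercyclic G B -> B \subset L -> exists n, B \subset 'Z_n(K) by apply: stab.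
  elim=> [|A {}B hA IH sAB nB pr] sBL.
    by exists 0; rewrite sub1G.
  have [n sAn] := IH (subset_trans sAB sBL); exists n.+1.
  apply/subsetP=> x Bx; rewrite ucnSnR inE (subsetP (subset_trans sBL sLK)) //=.
  apply: subset_trans sAn; apply: subset_trans (critical_stable (hypercyclic_normal hA) nB sAB pr).
  by rewrite commSg ?sub1set.
apply/ucnP; exists n.+1; apply/eqP; rewrite eqEsubset ucn_sub /=.
apply/subsetP=> x Kx; rewrite ucnSnR inE Kx /=.
apply: subset_trans sLn; apply: subset_trans sK'L.
by rewrite commSg ?sub1set.
Qed.

Lemma critical_pgroup : K^`(1) \subset L -> exists2 p, prime p & p.-group K.
Proof.
move=> /critical_nilpotent nilK.
have i1 : #|K : L| > 1 by rewrite indexg_gt1 proper_subn.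
exists (pdiv #|K : L|); first exact: pdiv_prime.
set p := pdiv _; have /dprodP[_ defK _ _] := nilpotent_pcoreC p nilK.
have n1 : 'O_p(K) <| G := gFnormal_trans _ nK.
have n2 : 'O_p^'(K) <| G := gFnormal_trans _ nK.
have [<-|s1] := chL n1 (pcore_sub _ _); first exact: pcore_pgroup.
have [e|s2] := chL n2 (pcore_sub _ _); last first.
  by case/negP: (proper_subn pL); rewrite -defK mul_subG.
have : p^'.-group K by rewrite -e pcore_pgroup.
move/pgroupP/(_ p (pdiv_prime i1) (dvdn_trans (pdiv_dvd _) (dvdn_indexg _ _))).
by rewrite !inE eqxx.
Qed.

Lemma critical_perfect B : K^`(1) = K -> hypercyclic G B -> K \subset 'C(B).
Proof.
move=> K'K; elim=> [|A {}B hA IH sAB nB pr]; first exact: cents1.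
have sBK := critical_stable (hypercyclic_normal hA) nB sAB pr.
have BKK : [~: B, K, K] = 1 by apply/commG1P; apply: (subset_trans sBK); rewrite centsC.
rewrite -K'K; apply/commG1P/three_subgroup => //.
by rewrite [[~: K, B]]commGC.
Qed.

Lemma critical_der1 : K^`(1) = K \/ K^`(1) \subset L.
Proof. exact: chL (gFnormal_trans _ nK) (der_sub _ _). Qed.

(** [f] need not commute with the action of [G]; normality of preimages suffices, which covers the
    map [d |-> [~ a, d]]. *)
Lemma hypercyclic_pullback (f : {morphism K >-> gT}) B :
  (forall A, A <| G -> f @*^-1 A <| G) -> hypercyclic G ('ker f)%G ->
  hypercyclic G B -> f @* K \subset B -> hypercyclic G K.
Proof.
move=> nf hker hB sfB.
suff -> : K = (f @*^-1 B)%G.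
  apply: (hypercyclic_transport (f := fun A => f @*^-1 A)%G) hB.
    suff -> : (f @*^-1 1)%G = ('ker f)%G by [].
    exact: val_inj.
  move=> A C hA hC sAC; split; rewrite ?morphpreS ?nf ?hypercyclic_normal //.
  rewrite /= -(morphpreIim f C) -(morphpreIim f A) index_morphpre ?subsetIl //.
  rewrite /= !(setIC (f @* K)); apply: index_setI_dvd.
  exact: normalS sAC (normal_sub (hypercyclic_normal hC)) (hypercyclic_normal hA).
apply: val_inj; rewrite /=; apply/eqP; rewrite eqEsubset subsetIl andbT.
by rewrite -sub_morphim_pre.
Qed.
End CriticalTheory.

Section CriticalPGroup.
Variables (gT : finGroupType) (G K L : {group gT}) (p : nat).
Hypotheses (nK : K <| G) (nL : L <| G) (pL : L \proper K) (hL : hypercyclic G L).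
Hypotheses (npr : ~~ prime #|K : L|).
Hypothesis chL : forall N : {group gT}, N <| G -> N \subset K -> N :=: K \/ N \subset L.
Hypotheses (p_pr : prime p) (pK : p.-group K).
Implicit Types A B N : {group gT}.

Let sLK := proper_sub pL.

(** With [B = <[a]> A] and [A] centralised by [K], the map [d |-> [~ a, d]] is a morphism from [K]
    to [A]. Its kernel is [K], so that [K] centralises [B], or lies in [L], and then the chain of
    [A] pulls back to [K]. *)
Lemma critical_centralizes B : hypercyclic G B -> B \subset L ->
  K \subset 'C(B) \/ hypercyclic G K.
Proof.
elim=> [|A {}B hA IH sAB nB pr] sBL; first by left; apply: cents1.
have nA := hypercyclic_normal hA; have hB := HypercyclicS hA sAB nB pr.
have [cA|] := IH (subset_trans sAB sBL); last by right.
have sBK := critical_stable nK nL pL npr chL nA nB sAB pr.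
have [a Ba nAa] : exists2 a, a \in B & a \notin A.
  by apply/subsetPn; rewrite -indexg_gt1 prime_gt1.
have nAB : B \subset 'N(A) := subset_trans (normal_sub nB) (normal_norm nA).
have defB : B :=: <[a]> * A.
  rewrite -norm_joinEl ?cycle_subG ?(subsetP nAB) //.
  have sJ : <[a]> <*> A \subset B by rewrite join_subG cycle_subG Ba.
  have nt : #|<[a]> <*> A : A| != 1%N.
    rewrite indexg_eq1 join_subG subxx andbT cycle_subG //.
  have /(prime_nt_dvdP pr nt) e : #|<[a]> <*> A : A| %| #|B : A|.
    by rewrite indexSg ?joing_subr.
  apply/esym; apply: (index1g sJ); apply/eqP; have := Lagrange_index sJ (joing_subr <[a]> A).
  by move/eqP; rewrite e -{2}[#|B : A|]mul1n eqn_pmul2r ?prime_gt0.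
have Af d : d \in K -> [~ a, d] \in A.
  by move=> Kd; apply: (subsetP sBK); rewrite mem_commg.
have AK u d : u \in A -> d \in K -> u ^ d = u.
  by move=> Au Kd; apply/conjg_fixP/commgP/commute_sym/(centP (subsetP cA d Kd)).
have sBKK := subset_trans sBL sLK.
have fM : {in K &, {morph (fun d => [~ a, d]) : x y / x * y}}.
  move=> x y Kx Ky /=; rewrite commgMJ AK ?Af //.
  apply: (centP (subsetP cA _ _)); last exact: Af.
  by rewrite (subsetP (subset_trans sAB sBKK)) ?Af.
pose f := Morphism fM.
have kerE d : d \in K -> (d \in 'ker f) = (d \in 'C[a]).
  move=> Kd; apply/kerP/cent1P => //= [/eqP/commgP/commute_sym //|/commute_sym h].
  exact/eqP/commgP.
have nf N : N <| G -> f @*^-1 N <| G.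
  move=> nN; apply/andP; split; first by rewrite subIset ?(normal_sub nK).
  apply/subsetP=> g Gg; rewrite inE; apply/subsetP=> _ /imsetP[d /morphpreP[Kd Nd] ->].
  have Kdg : d ^ g \in K by rewrite memJ_norm ?(subsetP (normal_norm nK)).
  apply/morphpreP; split=> //=; rewrite /= in Nd.
  have Ng : g \in 'N(N) := subsetP (normal_norm nN) g Gg.
  (* Writing [a ^ g^-1 = a ^+ j * c] with [c] in [A] gives [[~ a, d ^ g] = ([~ a, d] ^+ j) ^ g], so
     preimages of normal subgroups are normal. *)
  have : a ^ g^-1 \in <[a]> * A.
    by rewrite -defB memJ_norm // groupV (subsetP (normal_norm nB)).
  case/mulsgP=> _ c /cycleP[j ->] Ac eag.
  have -> : [~ a, d ^ g] = [~ a ^ g^-1, d] ^ g by rewrite conjRg conjgKV.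
  have cd : [~ c, d] = 1 by apply/eqP/conjg_fixP/AK.
  rewrite memJ_norm // eag commMgJ cd mulg1.
  have Kc : c \in K by rewrite (subsetP (subset_trans sAB sBKK)).
  rewrite commXg; last first.
    by apply/(centP (subsetP cA _ (subsetP sBKK a Ba)))/Af.
  by rewrite AK ?groupX ?Af.
have hker : hypercyclic G ('ker f)%G \/ K \subset 'C(B).
  have nker : 'ker f <| G by apply: (nf 1%G); apply: normal1.
  have [e|skL] := chL nker (subsetIl _ _); last by left; apply: hypercyclic_sub hL skL nker.
  right; rewrite defB centM subsetI cA andbT; apply/subsetP=> d Kd.
  by rewrite cent_cycle -kerE // e.
have [hker'|] := hker; last by left.
right; apply: (hypercyclic_pullback nf hker' hA).
by apply/subsetP=> _ /morphimP[d _ Kd ->]; apply: Af.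
Qed.

Lemma critical_exponent : (forall x, x \in K -> x ^+ crit_exp p K = 1) \/ hypercyclic G K.
Proof.
have [cL|] := critical_centralizes hL (subxx L); last by right.
have sLZ : L \subset 'Z(K) by rewrite subsetI sLK centsC.
have sD := unique_max_normal_der pK nK pL chL.
have sp := unique_max_normal_expgn pK nK pL chL.
pose f := Morphism (crit_expM p_pr sD sLZ sp).
have nf N : N <| G -> f @*^-1 N <| G.
  move=> nN; apply/andP; split; first by rewrite subIset ?(normal_sub nK).
  apply/subsetP=> g Gg; rewrite inE; apply/subsetP=> _ /imsetP[d /morphpreP[Kd Nd] ->].
  have Kdg : d ^ g \in K by rewrite memJ_norm ?(subsetP (normal_norm nK)).
  apply/morphpreP; split=> //=; rewrite /= in Nd.
  by rewrite -conjXg memJ_norm // (subsetP (normal_norm nN)).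
have nker : 'ker f <| G by apply: (nf 1%G); apply: normal1.
have [e|skL] := chL nker (subsetIl _ _).
  by left=> x Kx; apply: (@mker _ _ _ f); rewrite e.
right; apply: (hypercyclic_pullback nf _ hL); first exact: hypercyclic_sub hL skL nker.
by apply/subsetP=> _ /morphimP[d _ Kd ->]; apply: crit_exp_mem.
Qed.

Lemma critical_pgroup_hypercyclic (tau : sfunctor) :
  subgroup_functor tau -> inductive tau -> quasiregular tau ->
  tame_elements tau p G K -> hypercyclic G K.
Proof.
move=> tauF tauI qr tK; have [ex|//] := critical_exponent.
case/negP: npr.
apply: (tame_chief_prime pK nK nL pL chL tauF tauI _ nL) => //.
- by move=> x Kx; apply: (tame_crit p_pr tK (subxx K) Kx (ex x Kx)).
- exact/setIidPl.
move=> H pH tH sH.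
have := qr _ _ _ (K / L)%G p p_pr tH pH; rewrite /= (setIidPl sH); apply.
  exact: (unique_max_normal_minnormal nK nL pL chL).
by apply: sub_der1_abelian; apply: (unique_max_normal_der pK nK pL chL).
Qed.
End CriticalPGroup.

(** For a Sylow subgroup [Q] containing [H], coprime indices give [G = 'N_G(H) Q], so every
    conjugate of [H] lies in [Q]. *)
Lemma pnat_index_norm_pcore (gT : finGroupType) (p : nat) (G H : {group gT}) :
  H \subset G -> p.-group H -> p.-nat #|G : 'N_G(H)| -> H \subset 'O_p(G).
Proof.
move=> sHG pH pN; have [Q sylQ sHQ] := Sylow_superset sHG pH.
have [sQG pQ p'Q] := and3P sylQ.
have defG : 'N_G(H) * Q = G.
  by apply: coprime_index_mulG; rewrite ?subsetIl ?(pnat_coprime pN).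
have nc := gcore_normal sQG.
apply: subset_trans (pcore_max (pgroupS (gcore_sub _ _) pQ) nc).
apply/bigcapsP=> g Gg; rewrite -sub_conjgV.
have : g^-1 \in 'N_G(H) * Q by rewrite defG groupV.
case/mulsgP=> n q /setIP[_ nH] Qq ->.
by rewrite conjsgM (normP nH) -(conjGid Qq) conjSg.
Qed.

(* If k were outside B, the double coset B k B would have at most |G| - |B|
   elements, so |B : B :&: B^k| would be a divisor of |G| below pdiv #|G|. *)
Lemma index_pdiv_normal (gT : finGroupType) (G B : {group gT}) :
  B \subset G -> #|G : B| = pdiv #|G| -> B <| G.
Proof.
move=> sBG iB; rewrite /normal sBG; apply/subsetP=> k Gk; rewrite inE.
have [Bk|nBk] := boolP (k \in B); first by rewrite conjGid.
have sBkG : B :^ k \subset G by rewrite -(conjGid Gk) conjSg.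
have sub : B :^ k * B \subset G :\: (k^-1 *: B).
  apply/subsetP=> _ /mulsgP[_ b /imsetP[a Ba ->] Bb ->].
  rewrite inE groupM ?(subsetP sBG b) ?groupJ ?(subsetP sBG a) // andbT.
  rewrite mem_lcoset invgK conjgE !mulgA mulgV mul1g.
  by rewrite groupMr // groupMl.
have le : #|B :^ k * B| <= #|G| - #|B|.
  apply: leq_trans (subset_leq_card sub) _; rewrite cardsD (setIidPr _) ?card_lcoset //.
  by rewrite -(lcoset_id (groupVr Gk)) mulgS.
have := mul_cardG (B :^ k) B; rewrite cardJg => e.
have gt0 := cardG_gt0 B.
have i1 : #|B : B :^ k| = 1%N.
  apply/eqP; rewrite eqn_leq indexg_gt0 andbT leqNgt; apply/negP=> i_gt1.
  have d : #|B : B :^ k| %| #|G| := dvdn_trans (dvdn_indexg _ _) (cardSg sBG).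
  have := pdiv_min_dvd i_gt1 d; rewrite -iB => le_p.
  have eL : (#|B : B :^ k| * #|B :^ k :&: B|)%N = #|B|.
    by rewrite -indexgI setIC mulnC Lagrange // subsetIr.
  have eG := Lagrange sBG.
  have : #|B :^ k * B| = (#|B : B :^ k| * #|B|)%N.
    apply/eqP; rewrite -(eqn_pmul2r (cardG_gt0 (B :^ k :&: B))) -e /=.
    by rewrite -mulnA [X in _ == (_ * X)%N]mulnC mulnA eL.
  move=> eBB; move: le; rewrite eBB -eG mulnC -[X in _ - X]muln1 -mulnBr leq_pmul2l //.
  rewrite leqNgt => /negP; apply; rewrite -subSn ?indexg_gt0 // subn1 /=.
  exact: le_p.
have /eqP := i1; rewrite indexg_eq1 => sB.
have /eqP <- : B == B :^ k :> {set gT} by rewrite eqEcard sB cardJg leqnn.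
by [].
Qed.

(** * The perfect minimal non-hypercyclic subgroup *)

Section CriticalPerfect.
Variables (gT : finGroupType) (G K L : {group gT}) (tau : sfunctor).
Hypotheses (nK : K <| G) (nL : L <| G) (pL : L \proper K) (hL : hypercyclic G L).
Hypotheses (npr : ~~ prime #|K : L|).
Hypothesis chL : forall N : {group gT}, N <| G -> N \subset K -> N :=: K \/ N \subset L.
Hypothesis K'K : K^`(1) = K.
Hypotheses (tauF : subgroup_functor tau) (tauI : inductive tau) (tauR : regular tau).

Let sLK := proper_sub pL.
Local Notation p := (pdiv #|K|).

Lemma critical_not_hypercyclic : ~ hypercyclic G K.
Proof.
move=> hK; case/negP: npr; apply: (hypercyclic_chief hK nK nL pL (subxx K)) => N nN sLN sNK.
by have [|sNL] := chL nN sNK; [right | left; apply/eqP; rewrite eqEsubset sNL].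
Qed.

Lemma critical_nontrivial : K :!=: 1.
Proof. by apply: contraTneq pL => ->; rewrite properE sub1G andbF. Qed.

Lemma critical_pdiv_prime : prime p.
Proof. by rewrite pdiv_prime // cardG_gt1 critical_nontrivial. Qed.

Lemma perfect_solvable_quotient (N : {group gT}) : N <| K -> solvable (K / N) -> K \subset N.
Proof.
move=> nN solKN; have nNK := normal_norm nN.
rewrite -(quotient_sub1 nNK) subG1; apply: contraT => nt.
have := sol_der1_proper solKN (subxx _) nt.
by rewrite -quotient_der // K'K properxx.
Qed.

Lemma critical_tame_mem x : x \in K -> p.-elt x -> x ^+ p \in L ->
  tame tau G <[x]>%G -> x \in L.
Proof.
move=> Kx px xpL tx; apply: contraT => nLx.
have cL := critical_perfect nK nL pL npr chL K'K hL.
have sxK : <[x]> \subset K by rewrite cycle_subG.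
have sxG := subset_trans sxK (normal_sub nK).
have p_pr := critical_pdiv_prime.
case: tx => [[T pT HT]|[Z hZ sZ]|tH].
- have sTG := proper_sub pT.
  have nsKT : ~~ (K \subset T).
    apply: contra (proper_subn pT) => sKT; rewrite -{1}HT mulG_subG subxx andbT.
    exact: subset_trans sKT.
  pose B := (K :&: T)%G.
  have defK : <[x]> * B = K.
    by rewrite /= setIC group_modl // HT; apply/setIidPr/normal_sub.
  (* [B2] has index 1 or [p] in [K]; as [p] is the least prime divisor of [|K|], it is normal, and
     perfection forces [K = B2]. Since [x ^+ p] is central in [K], [B] is normal with abelian
     quotient, so [K = B] lies in [T]. *)
  pose B2 := (B <*> <[x ^+ p]>)%G.
  have sB2 : B2 \subset K by rewrite join_subG subsetIl cycle_subG groupX.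
  have iB2 : #|K : B2| %| p.
    have /comm_group_setP cxB : group_set (<[x]> * B) by rewrite defK groupP.
    have -> : #|K : B2| = #|<[x]> : B2|.
      rewrite -(indexMg B2 <[x]>); congr #|_ : _|; apply/eqP; rewrite eqEsubset mul_subG // andbT.
      by rewrite -{1}defK cxB mulSg ?joing_subl.
    apply: dvdn_trans (indexgS _ (joing_subr B <[x ^+ p]>)) _.
    have sxp : <[x ^+ p]> \subset <[x]> by rewrite cycle_subG mem_cycle.
    suff -> : #|<[x]> : <[x ^+ p]>| = gcdn #[x] p by rewrite dvdn_gcdr.
    apply/eqP; rewrite -(eqn_pmul2l (order_gt0 (x ^+ p))) Lagrange // -/(#[x]) orderXgcd.
    by rewrite divnK ?dvdn_gcdl.
  have nB2 : B2 <| K.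
    have [i1|ni1] := eqVneq #|K : B2| 1%N.
      by rewrite (_ : B2 = K) ?normal_refl //; apply/val_inj/(index1g sB2).
    by apply: index_pdiv_normal => //; apply/(prime_nt_dvdP p_pr ni1).
  have sKB2 : K \subset B2.
    apply: perfect_solvable_quotient => //; apply: (@pgroup_sol _ p).
    by rewrite /pgroup card_quotient ?normal_norm // (pnat_dvd iB2) // pnat_id.
  have cBx : <[x ^+ p]> \subset 'C(K) by rewrite cycle_subG (subsetP _ _ xpL) // centsC.
  have nBx : <[x ^+ p]> \subset 'N(B).
    by apply/cents_norm/(subset_trans cBx)/centS/subsetIl.
  have nB : B <| K.
    by rewrite /normal subsetIl (subset_trans sKB2) // join_subG normG.
  case/negP: nsKT; apply: subset_trans (subsetIr K T).
  apply: perfect_solvable_quotient => //.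
  apply: (solvableS (quotientS B sKB2)).
  by rewrite /= quotientYidl // quotient_sol // abelian_sol // cycle_abelian.
- have nZK : Z :&: K <| G by rewrite normalI ?(hypercyclic_normal hZ).
  have Zx : x \in Z by apply: (subsetP sZ); apply: cycle_id.
  have [/setIidPr sKZ|sL] := chL nZK (subsetIr _ _).
    by case: critical_not_hypercyclic; apply: hypercyclic_sub hZ sKZ nK.
  by rewrite -(negPf nLx) (subsetP sL) // inE Zx.
have nc := gcore_normal sxG.
have sc : gcore <[x]> G \subset K := subset_trans (gcore_sub _ _) sxK.
have [e|scL] := chL nc sc.
  case: critical_not_hypercyclic; apply: cyclic_hypercyclic => //.
  by rewrite -e (cyclicS (gcore_sub _ _)) ?cycle_cyclic.
have tL := tau_quotient tauF tauI nc nL scL sxG tH.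
have minL := unique_max_normal_minnormal nK nL pL chL.
have pH : p.-group (<[x]> / L) by rewrite quotient_pgroup.
have sHK : <[x]> / L \subset K / L by rewrite quotientS.
have := tauR p_pr tL pH minL; rewrite /= (setIidPl sHK) => pN.
(* The image of [x] is nontrivial and lies in ['O_p(G / L)], so the minimal normal [K / L] is a
   p-group, against the perfection of [K]. *)
have sHO := pnat_index_norm_pcore (quotientS L sxG) pH pN.
have nLx' : x \in 'N(L) := subsetP (subset_trans (normal_sub nK) (normal_norm nL)) x Kx.
have [_ min] := mingroupP minL.
have nI : (K / L) :&: 'O_p(G / L) <| G / L.
  by rewrite normalI ?pcore_normal ?quotient_normal.
have [I1|ntI] := eqVneq ((K / L) :&: 'O_p(G / L)) 1.
  have Hx : coset L x \in <[x]> / L by rewrite mem_quotient ?cycle_id.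
  have : coset L x \in (K / L) :&: 'O_p(G / L).
    by rewrite inE (subsetP sHK) ?(subsetP sHO).
  by rewrite I1 => /set1gP/(coset_idr nLx') Lx; rewrite Lx in nLx.
have eI : (K / L) :&: 'O_p(G / L) = K / L.
  by apply: (min (_ :&: _)%G); rewrite ?subsetIl //= ntI normal_norm.
case/negP: (proper_subn pL); apply: perfect_solvable_quotient.
  by apply: normalS nL => //; apply: normal_sub.
by rewrite -eI; apply: solvableS (subsetIr _ _) (pgroup_sol (pcore_pgroup _ _)).
Qed.

End CriticalPerfect.

Lemma coprime_pdiv_pred n m : 1 < n -> m %| n -> coprime m (pdiv n).-1.
Proof.
move=> n_gt1 dmn; have p_gt1 := prime_gt1 (pdiv_prime n_gt1).
rewrite /coprime; apply: contraT => ne1; set p := pdiv n in p_gt1 ne1 *.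
have p1_gt0 : 0 < p.-1 by rewrite -subn1 subn_gt0.
have g_gt1 : 1 < gcdn m p.-1 by rewrite ltn_neqAle eq_sym ne1 gcdn_gt0 p1_gt0 orbT.
have d1 := dvdn_trans (dvdn_gcdl m p.-1) dmn.
have := leq_trans (pdiv_min_dvd g_gt1 d1) (dvdn_leq p1_gt0 (dvdn_gcdr m p.-1)).
by rewrite -/p -ltnS prednK ?ltnn // ltnW.
Qed.

(** A failure of the condition yields [D] and [L] with [|D : L| = p]. As [p] is the least prime
    divisor of [|E|], [|A|] is prime to [p.-1], so [A] centralises [D / L], contrary to [[~: D, A] =
    D]. *)
Lemma p'normalizers_central_criterion (gT : finGroupType) (E : {group gT}) (p : nat) :
  1 < #|E| -> p = pdiv #|E| ->
  (forall D L A : {group gT}, D \subset E -> A \subset E -> p.-group D ->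
     p^'.-group A -> A \subset 'N(D) -> L <| D <*> A -> L \proper D ->
     (forall N : {group gT}, N <| D <*> A -> N \subset D -> N :=: D \/ N \subset L) ->
     A \subset 'C(L) -> [~: D, A] = D -> (forall x, x \in D -> x ^+ crit_exp p D = 1) ->
     prime #|D : L|) ->
  p'normalizers_central p E.
Proof.
move=> E_gt1 defp crit Y y sYE pY /setIP[Ey nYy] p'y.
have p_pr : prime p by rewrite defp pdiv_prime.
rewrite -cycle_subG; apply: contraT => ncy.
have nYA : <[y]> \subset 'N(Y) by rewrite cycle_subG.
have sAE : <[y]> \subset E by rewrite cycle_subG.
have [D [L [[sDY nDA nL pL] [chL cL defD ex]]]] :=
  minimal_noncentral_action p_pr pY p'y nYA ncy.
have pD := pgroupS sDY pY; have sLD := proper_sub pL.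
have pr := crit D L <[y]>%G (subset_trans sDY sYE) sAE pD p'y nDA nL pL chL cL defD ex.
have co : coprime #|<[y]>| p.-1 by rewrite defp coprime_pdiv_pred ?cardSg.
have := coprime_act_prime pD nL nDA sLD pr co.
by rewrite defD => sDL; case/negP: (proper_subn pL).
Qed.

Lemma unique_max_normal_cyclic_prime (gT : finGroupType) (G D L : {group gT}) :
  D <| G -> L <| G -> L \proper D ->
  (forall N : {group gT}, N <| G -> N \subset D -> N :=: D \/ N \subset L) ->
  cyclic D -> prime #|D : L|.
Proof.
move=> nD nL pL chL cD; have /cyclicP[x eD] := cD.
have Dx : x \in D by rewrite eD cycle_id.
by apply: (unique_max_normal_prime nD nL pL chL Dx); rewrite {1}eD joing_subl.
Qed.

Lemma critical_perfect_false (gT : finGroupType) (G X K L : {group gT}) (tau : sfunctor) :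
  K <| G -> L <| G -> L \proper K -> hypercyclic G L -> ~~ prime #|K : L| ->
  (forall N : {group gT}, N <| G -> N \subset K -> N :=: K \/ N \subset L) ->
  K^`(1) = K -> subgroup_functor tau -> inductive tau -> regular tau ->
  K \subset X ->
  (forall (p : nat) (P : {group gT}), prime p -> p.-Sylow(X) P -> ~~ cyclic P ->
     tame_elements tau p G P) -> False.
Proof.
move=> nK nL pL hL npr chL K'K tauF tauI tauR sKX hX.
have sLK := proper_sub pL.
have p_pr := critical_pdiv_prime pL; set p := pdiv #|K| in p_pr *.
have cL := critical_perfect nK nL pL npr chL K'K hL.
have K_gt1 : 1 < #|K| by rewrite cardG_gt1 (critical_nontrivial pL).
have memL := critical_tame_mem nK nL pL hL npr chL K'K tauF tauI tauR.
have cent : p'normalizers_central p K.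
  apply: p'normalizers_central_criterion => // D L' A sDK sAK pD _ nDA nL' pL' chL' cL' defD ex.
  have nDM : D <| D <*> A by rewrite /normal joing_subl join_subG normG.
  have [P sylP sDP] := Sylow_superset (subset_trans sDK sKX) pD.
  have [cP|ncP] := boolP (cyclic P).
    exact: (unique_max_normal_cyclic_prime nDM nL' pL' chL' (cyclicS sDP cP)).
  have tP := hX p P p_pr sylP ncP.
  have L_prime x : x \in D -> prime #[x] -> x \in L.
    move=> Dx prx; apply: memL; rewrite ?(subsetP sDK) //.
    - exact: mem_p_elt pD Dx.
    - have : #[x] = p.
        by have := mem_p_elt pD Dx; rewrite /p_elt pnatE // => /eqP.
      by rewrite -/p => <-; rewrite expg_order group1.
    by have [t _] := tP x (subsetP sDP x Dx); apply: t.
  (* Elements of [D] have order 1, [p] or 4. One of order 4 has its square in [L] by the prime case,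
     so [memL] applies to it too. Then [A], being inside [K], centralises [D]. *)
  have sDL : D \subset L.
    apply/subsetP=> x Dx; case: (crit_exp_order p_pr (ex x Dx)) => [->|prx|[p2 nab o4]].
    - exact: group1.
    - exact: L_prime.
    have Lx2 : x ^+ p \in L.
      rewrite p2; apply: L_prime; first exact: groupX.
      by rewrite orderXdiv o4.
    apply: memL; rewrite ?(subsetP sDK) ?(mem_p_elt pD Dx) //.
    have [_ t] := tP x (subsetP sDP x Dx); apply: t => //.
    by apply: contra nab; apply: abelianS.
  case/negP: (proper_subn pL'); rewrite -defD (commG1P _) ?sub1G //.
  apply: subset_trans sDL _; rewrite centsC (subset_trans sAK) //.
have := p'normalizers_central_pcore p_pr cent.
have nO : 'O_p^'(K) <| K := pcore_normal _ _.
rewrite -card_quotient ?normal_norm // => pKO.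
have sKO := perfect_solvable_quotient K'K nO (pgroup_sol pKO).
have : p^'.-group K by apply: pgroupS sKO (pcore_pgroup _ _).
move/pgroupP/(_ p p_pr (pdiv_dvd _)).
by rewrite !inE eqxx.
Qed.

Theorem tame_hypercyclic (gT : finGroupType) (G X : {group gT}) (tau : sfunctor) :
  X <| G -> subgroup_functor tau -> inductive tau -> quasiregular tau ->
  regular tau \/ solvable X ->
  (forall (p : nat) (P : {group gT}), prime p -> p.-Sylow(X) P -> ~~ cyclic P ->
     tame_elements tau p G P) ->
  hypercyclic G X.
Proof.
move=> nX tauF tauI tauQ regsol hX; apply: hypercyclic_min_ind => // K nK sKX hK.
have [//|[L [nL pL hL npr chL]]] := min_nonhypercyclic nK hK.
have [K'K|K'L] := critical_der1 nK chL.
  case: regsol => [tauR|solX].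
    by case: (critical_perfect_false nK nL pL hL npr chL K'K tauF tauI tauR sKX hX).
  have := sol_der1_proper (solvableS sKX solX) (subxx K) (critical_nontrivial pL).
  by rewrite K'K properxx.
have [p p_pr pK] := critical_pgroup nK nL pL hL npr chL K'L.
have [P sylP sKP] := Sylow_superset sKX pK.
have [cP|ncP] := boolP (cyclic P).
  by apply: cyclic_hypercyclic => //; apply: cyclicS sKP cP.
apply: (critical_pgroup_hypercyclic nK nL pL hL npr chL p_pr pK tauF tauI tauQ).
exact: tame_elementsS (hX p P p_pr sylP ncP) sKP.
Qed.

Lemma regular_quasiregular tau : regular tau -> quasiregular tau.
Proof. by move=> h gT G H N p p_pr tH pH minN _; apply: h. Qed.

Lemma subnormal_nilpotent_Fitting (gT : finGroupType) (K Q : {group gT}) :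
  Q <|<| K -> nilpotent Q -> Q \subset 'F(K).
Proof.
move: {2}_.+1 (ltnSn #|K|) => n; elim: n => // n IH in K *.
rewrite ltnS => len /subnormalEr[eQ|[M [snQM nMK pMK]]] nilQ.
  by rewrite -eQ (nilpotent_Fitting nilQ).
apply: subset_trans (IH M (leq_trans (proper_card pMK) len) snQM nilQ) _.
by apply: Fitting_max (Fitting_nil M); apply: gFnormal_trans.
Qed.

(** * From the Fitting and generalized Fitting subgroups to the whole group *)

Section FittingExtension.
Variables (gT : finGroupType) (G E : {group gT}).
Hypothesis nE : E <| G.

Lemma hypercyclic_Fitting :
  solvable E -> hypercyclic G 'F(E)%G -> hypercyclic G E.
Proof.
move=> solE hF; apply: hypercyclic_min_ind => // K nK sKE hK.
have [//|[L [nL pL hL npr chL]]] := min_nonhypercyclic nK hK.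
apply: (hypercyclic_sub hF _ nK).
have [K'K|K'L] := critical_der1 nK chL.
  have := sol_der1_proper (solvableS sKE solE) (subxx K) (critical_nontrivial pL).
  by rewrite K'K properxx.
apply: Fitting_max; first by apply: normalS nK => //; apply: normal_sub.
exact: (critical_nilpotent nK nL pL hL npr chL K'L).
Qed.

Lemma hypercyclic_genFitting (X : {group gT}) :
  X :=: genFitting E -> hypercyclic G X -> hypercyclic G E.
Proof.
move=> defX hX; apply: hypercyclic_min_ind => // K nK sKE hK.
have [//|[L [nL pL hL npr chL]]] := min_nonhypercyclic nK hK.
have nKE : K <| E by apply: normalS nK => //; apply: normal_sub.
have [K'K|K'L] := critical_der1 nK chL; last first.
  apply: (hypercyclic_sub hX _ nK); rewrite defX.
  apply: subset_trans (joing_subl _ _).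
  by apply: Fitting_max => //; apply: (critical_nilpotent nK nL pL hL npr chL K'L).
have cK B := critical_perfect nK nL pL npr chL K'K (B := B).
have ntK := critical_nontrivial pL; have sLK := proper_sub pL.
have sFL : 'F(K) \subset L.
  have [e|//] := chL _ (gFnormal_trans _ nK) (Fitting_sub K).
  have := sol_der1_proper (nilpotent_sol (Fitting_nil K)) (subxx _).
  by rewrite e K'K properxx => /(_ ntK).
(* By minimality every proper normal subgroup of [Q] lies in [L], which [K] centralises; this makes
   [Q] quasisimple. *)
have [Q minQ _] : {Q : {group gT} | [min Q of R | (R <|<| K) && ~~ (R \subset L)] & Q \subset K}.
  by apply: mingroup_exists; rewrite subnormal_refl proper_subn.
have [/andP[snQ nsQL] min] := mingroupP minQ.
have sQK := subnormal_sub snQ.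
have normQ (R : {group gT}) : R <| Q -> R :=: Q \/ R \subset L.
  move=> nRQ; have [|nsRL] := boolP (R \subset L); [by right | left].
  apply: min; last exact: normal_sub.
  by rewrite nsRL (subnormal_trans (normal_subnormal nRQ)).
have cLQ : L \subset 'C(Q) by rewrite centsC (subset_trans sQK) ?cK.
have Q'Q : Q^`(1) = Q.
  have [//|sQ'L] := normQ _ (der_normal 1 Q).
  case/negP: nsQL; apply: subset_trans sFL; apply: subnormal_nilpotent_Fitting snQ _.
  apply/lcnP; exists 2; rewrite lcnSn lcn2; apply/commG1P.
  exact: subset_trans sQ'L cLQ.
have nsQZ : ~~ (Q \subset 'Z(Q)).
  apply/negP=> sQZ; case/negP: nsQL; rewrite -Q'Q (_ : Q^`(1) = 1) ?sub1G //.
  by apply/derG1P; rewrite /abelian (subset_trans sQZ) ?subsetIr.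
have qsQ : quasisimple Q.
  apply/andP; split; first by rewrite -{3}Q'Q.
  apply/mingroupP; split=> [|N /andP[ntN nN] sN].
    by rewrite -subG1 quotient_sub1 ?gFnorm // nsQZ normG.
  have nRQ : coset 'Z(Q) @*^-1 N <| Q.
    have : coset 'Z(Q) @*^-1 N <| coset 'Z(Q) @*^-1 (Q / 'Z(Q)).
      by rewrite cosetpre_normal /normal sN.
    by rewrite quotientGK ?center_normal.
  have [e|sRL] := normQ _ nRQ; first by rewrite /= -[LHS]cosetpreK; exact: (congr1 (fun A => A / 'Z(Q)) e).
  case/negP: ntN; rewrite -subG1 -(cosetpreK N) quotient_sub1.
    by rewrite subsetI (normal_sub nRQ) (subset_trans sRL).
  by rewrite (subset_trans (normal_sub nRQ)) ?gFnorm.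
have sQX : Q \subset X.
  rewrite defX; apply: subset_trans (joing_subr _ _); apply: sub_gen.
  apply: bigcup_sup; rewrite qsQ andbT.
  exact: subnormal_trans snQ (normal_subnormal nKE).
(* [K] centralises the hypercyclic [X], and [Q] lies in both, so [Q] would be abelian. *)
case/negP: nsQZ; rewrite subsetI subxx centsC.
by rewrite (subset_trans sQX) // centsC (subset_trans sQK) ?cK.
Qed.
End FittingExtension.

(** * Subdirect products and a twisted wreath product *)

Section SubdirectMorphisms.
Variable F : group_class.
Hypothesis formF : formation F.

Lemma formation_morphisms (sT aT bT cT : finGroupType) (S : {group sT})
    (q1 : {morphism S >-> aT}) (q2 : {morphism S >-> bT}) (q3 : {morphism S >-> cT}) :
  F (q2 @* S)%G -> F (q3 @* S)%G -> 'ker q2 :&: 'ker q3 \subset 'ker q1 ->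
  F (q1 @* S)%G.
Proof.
move=> F2 F3 sk; apply: (formation_isog formF (first_isog q1)).
apply: (@formation_subdirect F formF _ S ('ker q2)%G ('ker q3)%G ('ker q1)%G);
  rewrite ?ker_normal //; exact: formation_quotient_ker.
Qed.

(* With S the group of pairs (d (al y), y), the maps (d (al y), y) |-> y and
   (d (al y), y) |-> f d * y to Y / C have common kernel inside that of
   (g, y) |-> g N; this extends the fact that the abelian chief factors of
   groups in a formation are central with respect to it. *)
Lemma formation_equivariant_image (gT rT : finGroupType) (G D M N : {group gT})
    (Y C : {group rT}) (al : {morphism Y >-> gT}) (f : {morphism D >-> rT}) :
  D <| G -> D * M = G -> N <| G ->
  F Y -> C <| Y -> al @* Y = M -> C \subset 'ker al -> f @* D \subset Y ->
  {in D & Y, forall d y, coset C (f (d ^ al y)) = coset C (f d ^ y)} ->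
  {in D, forall d, f d \in C -> d \in N} ->
  F (G / N)%G.
Proof.
move=> nDG defG nNG FY nCY imal kal sfY eqv kf.
have sMG : M \subset G by rewrite -defG mulG_subr.
have alM y : y \in Y -> al y \in M by move=> Yy; rewrite -imal mem_morphim.
have nDM m : m \in M -> m \in 'N(D) by move/(subsetP sMG)/(subsetP (normal_norm nDG)).
(* [q] reads off the component in [D]: it sends [(d * al y, y)] to [d]. *)
pose q (u : gT * rT) := u.1 * (al u.2)^-1.
pose S := [set u : gT * rT | (u.2 \in Y) && (q u \in D)].
have qM u v : u.2 \in Y -> v.2 \in Y -> q (u * v) = q u * q v ^ (al u.2)^-1.
  move=> Yu Yv; rewrite /q /= morphM // conjgE invgK invMg !mulgA.
  by congr (_ * _); rewrite mulgKV.
have gS : group_set S.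
  apply/group_setP; split=> [|u v]; rewrite !inE.
    by rewrite /q /= morph1 invg1 mulg1 !group1.
  case/andP=> Yu Du /andP[Yv Dv]; apply/andP; split; first exact: groupM.
  by rewrite qM // groupM // memJ_norm // groupV nDM ?alM.
pose GS := Group gS.
have Sq u : u \in GS -> u.2 \in Y /\ q u \in D by rewrite inE => /andP.
have fY d : d \in D -> f d \in Y.
  by move=> Dd; apply: (subsetP sfY); rewrite mem_morphim.
have nCYe y : y \in Y -> y \in 'N(C) := subsetP (normal_norm nCY) y.
have m1 : {in GS &, {morph (fun u : gT * rT => coset N u.1) : u v / u * v}}.
  have S1 u : u \in GS -> u.1 \in 'N(N).
    case/Sq=> Yu Du; apply: (subsetP (normal_norm nNG)).
    rewrite -(mulgKV (al u.2) u.1) groupM ?(subsetP (normal_sub nDG) _ Du) //.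
    by rewrite (subsetP sMG) ?alM.
  by move=> u v Su Sv; rewrite /= morphM ?S1.
have m2 : {in GS &, {morph (fun u : gT * rT => coset C u.2) : u v / u * v}}.
  by move=> u v /Sq[Yu _] /Sq[Yv _]; rewrite /= morphM ?nCYe.
have m3 : {in GS &, {morph (fun u : gT * rT => coset C (f (q u) * u.2)) : u v / u * v}}.
  move=> u v /Sq[Yu Du] /Sq[Yv Dv] /=; have Yu' := groupVr Yu.
  have Dvu : q v ^ al u.2^-1 \in D by rewrite memJ_norm // nDM ?alM.
  have -> : f (q (u * v)) = f (q u) * f (q v ^ al u.2^-1) by rewrite qM // -morphV // morphM.
  have e2 := eqv (q v) u.2^-1 Dv Yu'.
  have Nf d : d \in D -> f d \in 'N(C) by move=> Dd; rewrite nCYe ?fY.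
  have [Nu Nv] := (nCYe _ Yu, nCYe _ Yv).
  have cM x y : x \in 'N(C) -> y \in 'N(C) -> coset C (x * y) = coset C x * coset C y.
    exact: morphM.
  have cJ x y : x \in 'N(C) -> y \in 'N(C) -> coset C (x ^ y^-1) = coset C x ^ (coset C y)^-1.
    by move=> Nx Ny; rewrite -morphV // -morphJ ?groupV.
  rewrite (cM (_ * _)) ?groupM ?Nf // (cM (f _)) ?Nf // e2 cJ ?Nf //.
  by rewrite (cM u.2) // !(cM (f _)) ?Nf // conjgE invgK !mulgA mulgKV.
pose q1 := Morphism m1; pose q2 := Morphism m2; pose q3 := Morphism m3.
have Sal y : y \in Y -> (al y, y) \in GS by move=> Yy; rewrite inE /q /= Yy mulgV group1.
have im1 : q1 @* GS = G / N.
  apply/setP=> x; apply/morphimP/morphimP => [[u Su _ ->]|[g nNg Gg ->]].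
    have [Yu Du] := Sq u Su.
    have Gu : u.1 \in G.
      rewrite -(mulgKV (al u.2) u.1) groupM ?(subsetP (normal_sub nDG) _ Du) //.
      by rewrite (subsetP sMG) ?alM.
    by exists u.1 => //; apply: (subsetP (normal_norm nNG)).
  move: Gg; rewrite -{1}defG => /mulsgP[d m Dd Mm eg].
  move: Mm; rewrite -imal => /morphimP[y _ Yy em].
  have Su : (g, y) \in GS by rewrite inE /q /= Yy eg em mulgK.
  by exists (g, y).
have FYC : F (Y / C)%G by case: formF => _ h _; apply: h.
have im2 : q2 @* GS = Y / C.
  apply/setP=> x; apply/morphimP/morphimP => [[u Su _ ->]|[y nCy Yy ->]].
    by have [Yu _] := Sq u Su; exists u.2 => //; apply: nCYe.
  by exists (al y, y) => //; apply: Sal.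
have im3 : q3 @* GS = Y / C.
  apply/setP=> x; apply/morphimP/morphimP => [[u Su _ ->]|[y nCy Yy ->]].
    have [Yu Du] := Sq u Su; exists (f (q u) * u.2) => //; last by rewrite groupM ?fY.
    by rewrite nCYe ?groupM ?fY.
  by exists (al y, y); rewrite ?Sal //= /q /= mulgV morph1 mul1g.
rewrite (_ : (G / N)%G = (q1 @* GS)%G); last by apply: val_inj.
apply: (@formation_morphisms _ _ _ _ GS q1 q2 q3).
- by rewrite (_ : (q2 @* GS)%G = (Y / C)%G) //; apply: val_inj.
- by rewrite (_ : (q3 @* GS)%G = (Y / C)%G) //; apply: val_inj.
apply/subsetP=> u /setIP[ku2 ku3]; have Su := dom_ker ku2.
have [Yu Du] := Sq u Su; have nu := nCYe _ Yu.
have Cu : u.2 \in C by apply: coset_idr => //; apply: (mker ku2).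
have Cfu : f (q u) \in C.
  rewrite -(groupMr _ Cu); apply: coset_idr; last exact: (mker ku3).
  by rewrite nCYe ?groupM ?fY.
have al1 : al u.2 = 1 by apply: mker; apply: (subsetP kal).
apply/kerP => //=; apply: coset_id; have := kf _ Du Cfu.
by rewrite /q al1 invg1 mulg1.
Qed.
End SubdirectMorphisms.

(* The semidirect product of the functions gT -> gT (under pointwise product)
   by gT * gT, where (a, b) sends f to t |-> (f (a^-1 t b)) ^ a^-1. *)
Record twisted_wreath (gT : finGroupType) :=
  TwistedWreath { tw_fun : {ffun gT -> gT}; tw_left : gT; tw_right : gT }.

Section TwistedWreathGroup.
Variable gT : finGroupType.
Local Notation wT := (twisted_wreath gT).

Definition tw_pair (u : wT) := (tw_fun u, tw_left u, tw_right u).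
Definition tw_of_pair (x : {ffun gT -> gT} * gT * gT) : wT := TwistedWreath x.1.1 x.1.2 x.2.
Lemma tw_pairK : cancel tw_pair tw_of_pair. Proof. by case. Qed.
HB.instance Definition _ := Finite.copy wT (can_type tw_pairK).

Definition tw_mul (u v : wT) : wT :=
  TwistedWreath
    [ffun t => tw_fun u t * tw_fun v ((tw_left u)^-1 * t * tw_right u) ^ (tw_left u)^-1]
    (tw_left u * tw_left v) (tw_right u * tw_right v).
Definition tw_one : wT := TwistedWreath [ffun=> 1] 1 1.
Definition tw_inv (u : wT) : wT :=
  TwistedWreath [ffun t => (tw_fun u (tw_left u * t * (tw_right u)^-1))^-1 ^ tw_left u]
    (tw_left u)^-1 (tw_right u)^-1.

Lemma tw_mulA : associative tw_mul.
Proof.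
move=> [f a b] [g c d] [h e k]; congr TwistedWreath; rewrite /= ?mulgA //.
by apply/ffunP=> t; rewrite !ffunE /= conjMg -conjgM -invMg invMg !mulgA.
Qed.

Lemma tw_mul1 : left_id tw_one tw_mul.
Proof.
move=> [f a b]; congr TwistedWreath; rewrite /= ?mul1g //.
by apply/ffunP=> t; rewrite !ffunE /= invg1 conjg1 !mul1g mulg1.
Qed.

Lemma tw_mulV : left_inverse tw_one tw_inv tw_mul.
Proof.
move=> [f a b]; congr TwistedWreath; rewrite /= ?mulVg //.
by apply/ffunP=> t; rewrite !ffunE /= invgK -conjMg mulVg conj1g.
Qed.

HB.instance Definition _ := Finite_isGroup.Build wT tw_mulA tw_mul1 tw_mulV.

Lemma tw_leftM (u v : wT) : tw_left (u * v) = tw_left u * tw_left v. Proof. by []. Qed.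
Lemma tw_rightM (u v : wT) : tw_right (u * v) = tw_right u * tw_right v. Proof. by []. Qed.
Lemma tw_funM (u v : wT) t : tw_fun (u * v) t =
  tw_fun u t * tw_fun v ((tw_left u)^-1 * t * tw_right u) ^ (tw_left u)^-1.
Proof. by rewrite /= ffunE. Qed.

Lemma tw_eqP (u v : wT) : (forall t, tw_fun u t = tw_fun v t) ->
  tw_left u = tw_left v -> tw_right u = tw_right v -> u = v.
Proof. by case: u v => [f a b] [g c d] /= /ffunP -> -> ->. Qed.
End TwistedWreathGroup.

Section TwistedWreathSubgroup.
Variables (gT : finGroupType) (p : nat) (M U Z : {group gT}).
Hypotheses (nUM : U <| M) (nZM : Z <| M) (pU : p.-group U) (pZ : p.-group Z).
Hypothesis abZ : abelian Z.
Local Notation wT := (twisted_wreath gT).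
Implicit Types (u v w : wT) (t z : gT).

Let V t : {group gT} := if t \in U then Z else 1%G.

(** Pairs [(a, b)] in [M] with [a U = b U] act on functions from [U] to [Z]: the congruence makes
    [t |-> a^-1 * t * b] preserve [U]. The value 1 outside [U] avoids a type depending on [U]. *)
Definition tw_base : {set wT} :=
  [set w | [&& tw_left w \in M, tw_right w \in M, (tw_left w)^-1 * tw_right w \in U &
    [forall t, tw_fun w t \in V t]]].

Lemma tw_baseP w : reflect [/\ tw_left w \in M, tw_right w \in M,
    (tw_left w)^-1 * tw_right w \in U & forall t, tw_fun w t \in V t] (w \in tw_base).
Proof.
rewrite inE; apply: (iffP and4P) => [[h1 h2 h3 /forallP h4]|[h1 h2 h3 h4]]; split=> //.
exact/forallP.
Qed.

Lemma tw_shift a b t : a \in M -> a^-1 * b \in U -> (a^-1 * t * b \in U) = (t \in U).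
Proof.
move=> Ma Uab; have -> : a^-1 * t * b = t ^ a * (a^-1 * b) by rewrite conjgE !mulgA mulgK.
by rewrite groupMr // memJ_norm // (subsetP (normal_norm nUM)).
Qed.

Lemma tw_baseV a b t z : a \in M -> a^-1 * b \in U -> z \in V (a^-1 * t * b) ->
  z ^ a^-1 \in V t.
Proof.
move=> Ma Uab; rewrite /V tw_shift //; case: ifP => _; last by move/set1P->; rewrite conj1g group1.
by rewrite memJ_norm // groupV (subsetP (normal_norm nZM)).
Qed.

Lemma tw_base_group : group_set tw_base.
Proof.
apply/group_setP; split.
  by apply/tw_baseP; split=> [|||t]; rewrite /= ?ffunE ?invg1 ?mulg1 group1.
move=> u v /tw_baseP[Mu Mu' Uu fu] /tw_baseP[Mv Mv' Uv fv]; apply/tw_baseP; split.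
- exact: groupM.
- exact: groupM.
- rewrite /= invMg -!mulgA.
  have -> : (tw_left v)^-1 * ((tw_left u)^-1 * (tw_right u * tw_right v)) =
            ((tw_left u)^-1 * tw_right u) ^ tw_left v * ((tw_left v)^-1 * tw_right v).
    by rewrite conjgE !mulgA mulgK.
  by rewrite groupM // memJ_norm // (subsetP (normal_norm nUM)).
by move=> t; rewrite tw_funM groupM // (tw_baseV Mu Uu).
Qed.
Canonical tw_base_Group := Group tw_base_group.
Local Notation Y := tw_base_Group.

Lemma tw_base_funZ w t : w \in Y -> tw_fun w t \in Z.
Proof. by case/tw_baseP=> _ _ _ /(_ t); rewrite /V; case: ifP => // _ /set1P->; apply: group1. Qed.

Definition tw_sum w : gT := fmval (\sum_(t in U) fmod abZ (tw_fun w t))%R.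

Lemma tw_sum_mem w : tw_sum w \in Z.
Proof. exact: fmodP. Qed.

(** The shift permutes [U], so only conjugation affects the total. This cocycle identity makes
    [tw_sum w * tw_left w] a third morphism onto [M]. *)
Lemma tw_sumM u v : u \in Y -> v \in Y ->
  tw_sum (u * v) = tw_sum u * tw_sum v ^ (tw_left u)^-1.
Proof.
move=> Yu Yv; have [Mu Mu' Uu _] := tw_baseP _ Yu.
have NZ m : m \in M -> m \in 'N(Z) by apply/subsetP/normal_norm.
rewrite /tw_sum -fmvalJ ?NZ ?groupV // -fmvalA; congr fmval.
rewrite actr_sum.
rewrite [X in (_ = _ + X)%R](reindex_onto (fun t => (tw_left u)^-1 * t * tw_right u)
  (fun s => tw_left u * s * (tw_right u)^-1)) /=; last first.
  by move=> s _; rewrite !mulgA mulVg mul1g mulgKV.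
have -> : (\sum_(t in U) fmod abZ (tw_fun (u * v) t) =
  \sum_(t in U) (fmod abZ (tw_fun u t) +
    actr (fmod abZ (tw_fun v ((tw_left u)^-1 * t * tw_right u))) (tw_left u)^-1))%R.
  apply: eq_bigr => t _; rewrite tw_funM fmodM ?tw_base_funZ ?fmodJ ?NZ ?groupV //.
  by rewrite memJ_norm ?tw_base_funZ ?NZ ?groupV.
rewrite big_split /=; congr (_ + _)%R; apply: eq_bigl => t.
rewrite tw_shift // !mulgA mulgV mul1g mulgK eqxx andbT //.
Qed.

Lemma tw_leftP : {in Y &, {morph (@tw_left gT) : u v / u * v}}. Proof. by []. Qed.
Lemma tw_rightP : {in Y &, {morph (@tw_right gT) : u v / u * v}}. Proof. by []. Qed.
Lemma tw_totalP : {in Y &, {morph (fun w => tw_sum w * tw_left w) : u v / u * v}}.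
Proof.
by move=> u v Yu Yv /=; rewrite tw_sumM // conjgE invgK !mulgA mulgKV.
Qed.
Definition tw_left_morphism := Morphism tw_leftP.
Definition tw_right_morphism := Morphism tw_rightP.
Definition tw_total_morphism := Morphism tw_totalP.

Lemma tw_diag_mem m : m \in M -> TwistedWreath [ffun=> 1] m m \in Y.
Proof.
by move=> Mm; apply/tw_baseP; split=> //= [|t]; rewrite ?mulVg ?ffunE group1.
Qed.

Lemma tw_sum1 w : (forall t, tw_fun w t = 1) -> tw_sum w = 1.
Proof. by move=> w1; rewrite /tw_sum big1 // => t _; rewrite w1 fmod1. Qed.

Lemma tw_left_im : tw_left_morphism @* Y = M.
Proof.
apply/setP=> m; apply/morphimP/idP => [[w _ /tw_baseP[Mw _ _ _] ->] //|Mm].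
by exists (TwistedWreath [ffun=> 1] m m); rewrite ?tw_diag_mem.
Qed.

Lemma tw_right_im : tw_right_morphism @* Y = M.
Proof.
apply/setP=> m; apply/morphimP/idP => [[w _ /tw_baseP[_ Mw _ _] ->] //|Mm].
by exists (TwistedWreath [ffun=> 1] m m); rewrite ?tw_diag_mem.
Qed.

Lemma tw_total_im : tw_total_morphism @* Y = M.
Proof.
apply/setP=> m; apply/morphimP/idP => [[w _ /tw_baseP[Mw _ _ _] ->]|Mm].
  by rewrite groupM // (subsetP (normal_sub nZM)) ?tw_sum_mem.
exists (TwistedWreath [ffun=> 1] m m); rewrite ?tw_diag_mem //=.
by rewrite tw_sum1 ?mul1g // => t; rewrite ffunE.
Qed.

Local Notation N := ('ker tw_left_morphism)%G.

Lemma tw_kerP w : reflect [/\ w \in Y, tw_left w = 1 & tw_right w \in U] (w \in N).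
Proof.
apply: (iffP idP) => [kw|[Yw w1 _]]; last exact/kerP.
have Yw := dom_ker kw; have /= w1 := mker kw; split=> //.
by have [_ _ + _] := tw_baseP _ Yw; rewrite w1 invg1 mul1g.
Qed.

(** The [|U|]-th power of an element has both group components trivial; such elements multiply
    pointwise with values in [Z], so orders divide [|U| |Z|]. *)
Lemma tw_ker_pgroup : p.-group N.
Proof.
rewrite /pgroup -indexg1; apply: (@pnat_index_of_p'elts p _ N 1%G); first exact: normal1.
move=> w Nw p'w; suff pw : p.-elt w by rewrite -[w](constt_p_elt pw) (constt1P p'w).
have [Yw w1 Uw] := tw_kerP _ Nw.
rewrite /p_elt; apply: (@pnat_dvd _ (#|U| * #|Z|)); last by rewrite pnatM; apply/andP.
have Ynw n : w ^+ n \in Y by rewrite groupX.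
have leftX n : tw_left (w ^+ n) = 1.
  by elim: n => // n IH; rewrite expgS tw_leftM w1 IH mulg1.
have rightX n : tw_right (w ^+ n) = tw_right w ^+ n.
  by elim: n => // n IH; rewrite !expgS tw_rightM IH.
rewrite order_dvdn expgM; set v := w ^+ _.
have v1 : tw_left v = 1 by apply: leftX.
have v2 : tw_right v = 1 by rewrite rightX; apply/eqP; rewrite -order_dvdn order_dvdG.
have vX n : [/\ tw_left (v ^+ n) = 1, tw_right (v ^+ n) = 1 &
                forall t, tw_fun (v ^+ n) t = tw_fun v t ^+ n].
  elim: n => [|n [e1 e2 e3]]; first by split=> // t; rewrite /= ffunE.
  rewrite expgS; split; rewrite ?tw_leftM ?tw_rightM ?v1 ?v2 ?e1 ?e2 ?mulg1 //.
  by move=> t; rewrite tw_funM v1 v2 invg1 conjg1 mul1g mulg1 e3 -expgS.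
have [e1 e2 e3] := vX #|Z|; apply/eqP/tw_eqP=> [t||]; rewrite ?e1 ?e2 // e3 ffunE.
by apply/eqP; rewrite -order_dvdn order_dvdG //; apply: tw_base_funZ; apply: Ynw.
Qed.

Definition tw_delta t z : wT := TwistedWreath [ffun s => if s == t then z else 1] 1 1.

Lemma tw_deltaE t z s : tw_fun (tw_delta t z) s = if s == t then z else 1.
Proof. by rewrite ffunE. Qed.

Lemma tw_delta_ker t z : t \in U -> z \in Z -> tw_delta t z \in N.
Proof.
move=> Ut Zz; apply/tw_kerP; split; rewrite /= ?group1 //.
apply/tw_baseP; split; rewrite /= ?invg1 ?mulg1 ?group1 // => s.
by rewrite ffunE /V; case: eqP => [->|_]; rewrite ?Ut ?group1.
Qed.

Lemma tw_sum_delta t z : t \in U -> z \in Z -> tw_sum (tw_delta t z) = z.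
Proof.
move=> Ut Zz; rewrite /tw_sum (bigD1 t) //= ffunE eqxx big1 ?ssralg.GRing.addr0 ?fmodK //.
by move=> s /andP[_ /negPf ne]; rewrite ffunE ne fmod1.
Qed.

Lemma tw_delta_shift t z : t \in U -> z \in Z ->
  coset N^`(1) (tw_delta t z) = coset N^`(1) (tw_delta 1 z).
Proof.
move=> Ut Zz; pose s := TwistedWreath [ffun=> 1] 1 t.
have Ns : s \in N.
  apply/tw_kerP; split=> //; apply/tw_baseP.
  by split; rewrite /= ?invg1 ?mul1g ?(subsetP (normal_sub nUM)) ?group1 // => r; rewrite ffunE group1.
have N1 := tw_delta_ker (group1 U) Zz.
have eJ : tw_delta t z = tw_delta 1 z ^ s.
  apply/(mulgI s); rewrite -conjgC; apply: tw_eqP => [r||]; rewrite ?tw_leftM ?tw_rightM /= ?mul1g ?mulg1 //.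
  rewrite !ffunE invg1 !conjg1 !mul1g mulg1.
  by rewrite -[X in r * t == X]mul1g (inj_eq (mulIg t)).
have nN : N \subset 'N(N^`(1)) := der_norm 1 N.
rewrite eJ conjg_mulR; apply/esym.
have R1 : [~ tw_delta 1 z, s] \in N^`(1) by rewrite mem_commg.
by rewrite coset_kerr.
Qed.

(* Shifting by u moves the value of f at t to t u, so modulo N^`(1) all values
   can be collected at 1. *)
Lemma tw_coset_sum w : w \in N -> tw_right w = 1 ->
  coset N^`(1) w = coset N^`(1) (tw_delta 1 (tw_sum w)).
Proof.
pose supp w := [set t in U | (t != 1) && (tw_fun w t != 1)].
have nN : N \subset 'N(N^`(1)) := der_norm 1 N.
have [n] := ubnP #|supp w|; elim: n w => // n IH w; rewrite ltnS => len Nw w2.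
have [Yw w1 _] := tw_kerP _ Nw.
have Zf t : tw_fun w t \in Z by apply: tw_base_funZ.
have [s0|[t]] := set_0Vmem (supp w).
  congr coset; have f1 t : t \in U -> t != 1 -> tw_fun w t = 1.
    move=> Ut nt; apply/eqP; apply: contraT => nf.
    by have := in_set0 t; rewrite -s0 inE Ut nt nf.
  have -> : tw_sum w = tw_fun w 1.
    rewrite /tw_sum (bigD1 1) ?group1 //= big1 ?ssralg.GRing.addr0 ?fmodK ?Zf //.
    by move=> t /andP[Ut nt]; rewrite f1 // fmod1.
  apply: tw_eqP => // t; rewrite tw_deltaE; case: eqP => [-> //|/eqP nt].
  have [Ut|nUt] := boolP (t \in U); first exact: f1.
  by have [_ _ _ /(_ t)] := tw_baseP _ Yw; rewrite /V (negPf nUt) => /set1P.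
rewrite inE => /and3P[Ut nt nf]; set z := tw_fun w t in nf.
have Zz : z \in Z by apply: Zf.
(* Multiplying by [d] and [e] moves the value at [t] to 1: the sum is kept, the support shrinks, and
   [d * e] is trivial modulo the derived subgroup. *)
pose d := tw_delta t z^-1; pose e := tw_delta 1 z.
have Nd : d \in N by rewrite tw_delta_ker ?groupV.
have Ne : e \in N by rewrite tw_delta_ker ?group1.
have [Yd _ _] := tw_kerP _ Nd; have [Ye _ _] := tw_kerP _ Ne.
have fE s : tw_fun (w * d * e) s = tw_fun w s * tw_fun d s * tw_fun e s.
  have [dl dr] : tw_left d = 1 /\ tw_right d = 1 by [].
  by rewrite !tw_funM tw_leftM tw_rightM w1 w2 dl dr ?mulg1 !invg1 !conjg1 !mul1g ?mulg1.
have lt : #|supp (w * d * e)| < n.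
  apply: leq_trans len; apply: proper_card; apply/properP; split.
    apply/subsetP=> s; rewrite !inE fE !tw_deltaE => /and3P[-> ns /=].
    rewrite ns (negPf ns) mulg1 /=.
    by case: (eqVneq s t) => [-> //|_]; rewrite mulg1.
  exists t; first by rewrite inE Ut nt nf.
  by rewrite inE fE !tw_deltaE eqxx (negPf nt) mulg1 mulgV eqxx !andbF.
have Nwde : w * d * e \in N by rewrite !groupM.
have sumE : tw_sum (w * d * e) = tw_sum w.
  rewrite !tw_sumM ?groupM // tw_leftM w1 /= mulg1 invg1 !conjg1.
  by rewrite !tw_sum_delta ?groupV ?group1 // mulgKV.
have := IH _ lt Nwde; rewrite sumE !tw_rightM w2 !mulg1 => <- //.
have NN u : u \in N -> u \in 'N(N^`(1)) by apply: (subsetP nN).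
have cM u v : u \in N -> v \in N -> coset N^`(1) (u * v) = coset N^`(1) u * coset N^`(1) v.
  by move=> Nu Nv; rewrite morphM ?NN.
rewrite !cM ?groupM // tw_delta_shift ?groupV // -mulgA -cM ?tw_delta_ker ?groupV ?group1 //.
have -> : tw_delta 1 z^-1 * e = 1.
  apply: tw_eqP => [s||]; rewrite ?tw_leftM ?tw_rightM /= ?mulg1 //.
  by rewrite !ffunE /= invg1 conjg1 mul1g mulg1; case: eqP; rewrite ?mulVg ?mulg1.
by rewrite morph1 mulg1.
Qed.
End TwistedWreathSubgroup.

Section TwistedWreathFormation.
Variable F : group_class.
Hypotheses (formF : formation F) (satF : saturated F).
Variables (gT : finGroupType) (p : nat) (M U Z : {group gT}).
Hypotheses (nUM : U <| M) (nZM : Z <| M) (pU : p.-group U) (pZ : p.-group Z).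
Hypotheses (abZ : abelian Z) (FM : F M).

Local Notation Y := (tw_base_Group nUM nZM).
Local Notation al := (tw_left_morphism nUM nZM).
Local Notation be := (tw_right_morphism nUM nZM).
Local Notation ga := (tw_total_morphism nUM nZM abZ).

(* The kernels of the three maps onto M meet in the functions of sum 1, which
   are commutators in the normal p-subgroup ker al, hence Frattini. *)
Lemma tw_formation : F Y.
Proof.
pose K := ('ker al :&: 'ker be :&: 'ker ga)%G.
have n1 : 'ker al :&: 'ker be <| Y by rewrite normalI ?ker_normal.
have FK : F (Y / K)%G.
  have Fker (f : {morphism Y >-> gT}) : f @* Y = M -> F (Y / 'ker f)%G.
    move=> fY; apply: formation_quotient_ker => //.
    by rewrite (_ : (f @* Y)%G = M) //; apply: val_inj.
  have F1 : F (Y / ('ker al :&: 'ker be))%G.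
    case: (formF) => _ _ h; apply: h; rewrite ?ker_normal //.
      exact: Fker (tw_left_im _ _).
    exact: Fker (tw_right_im _ _).
  case: (formF) => _ _ h; apply: (h _ _ _ _ n1 (ker_normal _) F1).
  exact: Fker (tw_total_im _ _ _).
have nK : K <| Y := normalI n1 (ker_normal _).
apply: (saturated_sub_Phi formF satF nK) => //.
have nN : 'ker al <| Y := ker_normal _.
apply: subset_trans (Phi_normal_subset nN); rewrite (Phi_joing (tw_ker_pgroup nUM nZM pU pZ)).
apply: subset_trans (joing_subl _ _).
apply/subsetP=> w /setIP[/setIP[kal kbe] kga].
have w1 : tw_left w = 1 := mker kal; have w2 : tw_right w = 1 := mker kbe.
have sw : tw_sum U abZ w = 1.
  by have := mker kga; rewrite /= w1 mulg1.
apply: coset_idr; first by rewrite (subsetP (der_norm 1 _)).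
rewrite (tw_coset_sum abZ kal w2) sw.
rewrite (_ : tw_delta 1 1 = 1) ?morph1 //.
by apply: tw_eqP => // t; rewrite tw_deltaE ffunE; case: eqP.
Qed.
End TwistedWreathFormation.

Section CommutatorEmbedding.
Variable F : group_class.
Hypotheses (formF : formation F) (satF : saturated F).
Variables (gT : finGroupType) (p : nat) (G D M N U Z : {group gT}).
Hypotheses (nDG : D <| G) (defG : D * M = G) (nNG : N <| G).
Hypotheses (nUG : U <| G) (nZG : Z <| G) (sUM : U \subset M) (sZU : Z \subset U).
Hypotheses (pU : p.-group U) (sUD : U \subset D) (cDZ : D \subset 'C(Z)).
Hypotheses (sUDZ : [~: U, D] \subset Z) (sCN : 'C_D(U) \subset N) (FM : F M).

Let sMG : M \subset G. Proof. by rewrite -defG mulG_subr. Qed.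
Let nUM : U <| M := normalS sUM sMG nUG.
Let nZM : Z <| M := normalS (subset_trans sZU sUM) sMG nZG.
Let pZ : p.-group Z := pgroupS sZU pU.
Let cUZ : U \subset 'C(Z) := subset_trans sUD cDZ.
Let abZ : abelian Z := subset_trans sZU cUZ.
Local Notation wT := (twisted_wreath gT).
Local Notation Y := (tw_base_Group nUM nZM).
Local Notation al := (tw_left_morphism nUM nZM).

Let ZD z d : z \in Z -> d \in D -> z ^ d = z.
Proof.
by move=> Zz Dd; apply/conjg_fixP/commgP/commute_sym/(centP (subsetP cDZ d Dd)).
Qed.

Let UDZ t d : t \in U -> d \in D -> [~ t, d] \in Z.
Proof. by move=> Ut Dd; apply: (subsetP sUDZ); rewrite mem_commg. Qed.

Definition tw_comm d : wT := TwistedWreath [ffun t => if t \in U then [~ t, d] else 1] 1 1.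
Definition tw_const z : wT := TwistedWreath [ffun t => if t \in U then z else 1] 1 1.

Lemma tw_commM : {in D &, {morph tw_comm : d e / d * e}}.
Proof.
move=> d e Dd De; apply: tw_eqP => [t||]; rewrite ?tw_leftM ?tw_rightM /= ?mulg1 //.
rewrite !ffunE /= invg1 mul1g mulg1 conjg1; case: ifP => [Ut|_]; last by rewrite mulg1.
rewrite commgMJ ZD ?UDZ //.
by apply: (centP (subsetP cDZ _ _)) (UDZ Ut Dd); apply: (subsetP (subset_trans sZU sUD)); apply: UDZ.
Qed.
Canonical tw_comm_morphism := Morphism tw_commM.

Lemma tw_constM : {in Z &, {morph tw_const : y z / y * z}}.
Proof.
move=> y z Zy Zz; apply: tw_eqP => [t||]; rewrite ?tw_leftM ?tw_rightM /= ?mulg1 //.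
by rewrite !ffunE /= invg1 mul1g mulg1 conjg1; case: ifP; rewrite ?mulg1.
Qed.
Canonical tw_const_morphism := Morphism tw_constM.
Local Notation C := (tw_const_morphism @* Z)%G.

Lemma tw_fun_mem f : (forall t, t \in U -> f t \in Z) -> 
  TwistedWreath [ffun t => if t \in U then f t else 1] 1 1 \in Y.
Proof.
move=> fZ; apply/tw_baseP; split=> /=; rewrite ?group1 ?invg1 ?mulg1 ?group1 // => t.
by rewrite ffunE; case: (boolP (t \in U)) => [/fZ//|_]; rewrite group1.
Qed.

Lemma tw_conj f y : (forall t, t \in U -> f t \in Z) -> y \in Y ->
  TwistedWreath [ffun t => if t \in U then f t else 1] 1 1 ^ y =
  TwistedWreath [ffun t => if t \in U then
    f (tw_left y * t * (tw_right y)^-1) ^ tw_left y else 1] 1 1.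
Proof.
move=> fZ Yy; have [My My' Uy fy] := tw_baseP _ _ _ _ Yy.
apply/(mulgI y); rewrite -conjgC; apply: tw_eqP => [t||]; rewrite ?tw_leftM ?tw_rightM /= ?mul1g ?mulg1 //.
have et : tw_left y * ((tw_left y)^-1 * t * tw_right y) * (tw_right y)^-1 = t.
  by rewrite !mulgA mulgV mul1g mulgK.
rewrite !ffunE /= invg1 mul1g mulg1 conjg1 (tw_shift nUM t My Uy) et.
case: (boolP (t \in U)) => Ut; last by rewrite conj1g mulg1 mul1g.
rewrite -conjgM mulgV conjg1.
have Zfy : tw_fun y t \in Z by apply: tw_base_funZ Yy.
exact: (centsP abZ) (fZ t Ut) _ Zfy.
Qed.

(* d |-> (t |-> [t, d]) maps D to the base functions, G-equivariantly modulo the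
   constant functions C. *)
Lemma commutator_embedding_formation : F (G / N)%G.
Proof.
have FY : F Y by apply: (tw_formation formF satF nUM nZM pU pZ abZ FM).
have sCY : C \subset Y.
  by apply/subsetP=> _ /morphimP[z _ Zz ->]; apply: tw_fun_mem.
have nCY : C <| Y.
  rewrite /normal sCY; apply/subsetP=> y Yy; rewrite inE.
  apply/subsetP=> _ /imsetP[_ /morphimP[z _ Zz ->] ->].
  have [My _ _ _] := tw_baseP _ _ _ _ Yy.
  rewrite /= tw_conj //; apply/morphimP; exists (z ^ tw_left y) => //;
    by rewrite memJ_norm // (subsetP (normal_norm nZM)).
apply: (@formation_equivariant_image F formF _ _ G D M N Y C al tw_comm_morphism) => //.
- exact: tw_left_im.
- apply/subsetP=> _ /morphimP[z _ Zz ->]; apply/kerP => //.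
  exact: tw_fun_mem.
- by apply/subsetP=> _ /morphimP[d _ Dd ->]; apply: tw_fun_mem => t Ut; apply: UDZ.
- move=> d y Dd Yy; have [My My' Uy _] := tw_baseP _ _ _ _ Yy.
  set a := tw_left y in My Uy *; set b := tw_right y in My' Uy *.
  have Dda : d ^ a \in D by rewrite memJ_norm // (subsetP (normal_norm nDG)) ?(subsetP sMG).
  have Uba : b^-1 * a \in U by rewrite -groupV invMg invgK.
  (* Conjugation by [y] gives [[~ a * t * b^-1, d] ^ a = [~ t * (b^-1 * a), d ^ a]], which is
     [[~ t, d ^ a]] times [c], and [c] does not depend on [t]. *)
  pose c := [~ b^-1 * a, d ^ a].
  have Zc : c \in Z by apply: UDZ.
  have Dba : b^-1 * a \in D := subsetP sUD _ Uba.
  have -> : tw_comm d ^ y = tw_comm (d ^ a) * tw_const c.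
    rewrite tw_conj; [| by move=> t Ut; apply: UDZ | by []].
    apply: tw_eqP => [t||]; rewrite ?tw_leftM ?tw_rightM /= ?mul1g //.
    rewrite !ffunE /= invg1 mul1g mulg1 conjg1 -/a -/b; case: ifP => [Ut|_]; last by rewrite mulg1.
    rewrite conjRg (_ : (a * t * b^-1) ^ a = t * (b^-1 * a)); last first.
      by rewrite conjgE !mulgA mulVg mul1g.
    by rewrite commMgJ (ZD (UDZ Ut Dda) Dba).
  have Cc : tw_const c \in C by apply: (mem_morphim tw_const_morphism).
  rewrite coset_kerr //.
(* A constant commutator function is trivial, by its value at [t = 1], so [d] centralises [U]. *)
move=> d Dd /morphimP[z _ Zz /= edz]; apply: (subsetP sCN); rewrite inE Dd.
have fE t : t \in U -> [~ t, d] = z.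
  by move=> Ut; have := congr1 (fun w => tw_fun w t) edz; rewrite /= !ffunE Ut.
have z1 : z = 1 by rewrite -(fE 1) ?group1 // comm1g.
apply/centP=> t Ut; apply/commute_sym/commgP/eqP.
by rewrite fE // z1.
Qed.
End CommutatorEmbedding.

(** * The hereditary case *)

Lemma subcent_normal_group (gT : finGroupType) (G U D : {group gT}) :
  U <| G -> D <| G -> 'C_U(D) <| G.
Proof.
move=> /andP[sUG nUG] /andP[_ nDG]; rewrite /normal subIset ?sUG //=.
by rewrite normsI // (subset_trans nDG) ?cent_norm.
Qed.

(** * The primitive quotient by the core of a maximal subgroup *)

Section GcoreQuotient.
Variables (gT : finGroupType) (G D L M : {group gT}).
Hypotheses (nDG : D <| G) (nLG : L <| G) (maxM : maximal M G) (nsDM : ~~ (D \subset M)).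
Hypothesis defL : D :&: M = L.
Hypothesis chL : forall N : {group gT}, N <| G -> N \subset D -> N :=: D \/ N \subset L.
Local Notation C := (gcore_group M G).

Let sMG : M \subset G := proper_sub (maxgroupp maxM).

Lemma gcore_maximal_cap : C :&: D = L.
Proof.
apply/eqP; rewrite eqEsubset; apply/andP; split.
  by rewrite -defL setIC setIS ?gcore_sub.
by rewrite subsetI sub_gcore ?normal_norm // -defL subsetIl subsetIr.
Qed.

Lemma gcore_quotient_primitive : Defs.primitive (G / C)%G.
Proof.
have nC : C <| G := gcore_normal sMG.
have nCM : C <| M := normalS (gcore_sub _ _) sMG nC.
exists (M / C)%G; split; first by rewrite quotient_maximal.
have sMq : (M / C)%G \subset (G / C)%G by rewrite quotientS.
pose R := gcore_group (M / C)%G (G / C)%G.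
have nR : coset C @*^-1 R <| G by apply: cosetpre_normal_quotient (gcore_normal sMq).
have sR : coset C @*^-1 R \subset M by rewrite sub_cosetpre_quo ?gcore_sub.
suff /trivgP : R \subset (1 : {set _}) by [].
rewrite -(cosetpreK R) quotient_sub1; first by rewrite sub_gcore ?normal_norm.
exact: subset_trans (normal_sub nR) (normal_norm nC).
Qed.

Lemma gcore_quotient_minnormal : minnormal (D / C) (G / C).
Proof.
have nC : C <| G := gcore_normal sMG.
have [_ nCG] := andP nC; have [sDG nD] := andP nDG.
have nCD := subset_trans sDG nCG.
apply/mingroupP; split=> [|N /andP[ntN nN] sN].
  rewrite quotient_norms // andbT -subG1 quotient_sub1 //.
  by apply: contra nsDM => sDC; apply: subset_trans sDC (gcore_sub _ _).
have nNG : coset C @*^-1 N <| G.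
  apply: cosetpre_normal_quotient => //; rewrite /normal nN andbT.
  by rewrite (subset_trans sN) ?quotientS.
have nND : coset C @*^-1 N :&: D <| G by rewrite normalI.
have sNe x : coset C x \in N -> x \in 'N(C) -> x \in coset C @*^-1 N.
  by move=> Nx Cx; apply/morphpreP.
have [e|sNL] := chL nND (subsetIr _ _).
  apply/eqP; rewrite eqEsubset sN /=; apply/subsetP=> _ /morphimP[d nCd Dd ->].
  by move: Dd; rewrite -{1}e => /setIP[/morphpreP[]].
case/negP: ntN; rewrite -subG1; apply/subsetP=> x Nx.
have /morphimP[d nCd Dd ex] := subsetP sN x Nx.
have : d \in L by rewrite (subsetP sNL) // inE Dd sNe // -ex.
by rewrite -gcore_maximal_cap => /setIP[Cd _]; apply/set1gP; rewrite ex; apply: coset_id.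
Qed.
End GcoreQuotient.

Lemma tame_maximal_chief_prime (tau : sfunctor) (gT : finGroupType) (p : nat)
    (G D L M : {group gT}) :
  subgroup_functor tau -> inductive tau -> phi_quasiregular tau -> prime p ->
  p.-group D -> D <| G -> L <| G -> L \proper D ->
  (forall N : {group gT}, N <| G -> N \subset D -> N :=: D \/ N \subset L) ->
  maximal M G -> ~~ (D \subset M) -> D :&: M = L ->
  (forall x, x \in D -> tame tau G <[x]>%G) -> prime #|D : L|.
Proof.
move=> tauF tauI tauQ p_pr pD nDG nLG pL chL maxM nsDM defL tD.
have sMG := proper_sub (maxgroupp maxM).
have capC := gcore_maximal_cap nLG defL.
apply: (tame_chief_prime pD nDG nLG pL chL tauF tauI tD (gcore_normal sMG) capC).
move=> H pH tH sH.
have := tauQ _ _ _ _ _ (gcore_quotient_primitive maxM) p_pr tH pH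
  (gcore_quotient_minnormal nDG nLG maxM nsDM defL chL).
rewrite /= (setIidPl sH); apply; apply: quotient_cents2r.
apply: subset_trans (unique_max_normal_der pD nDG pL chL) _.
by rewrite -capC subsetIl.
Qed.

Section NormalPGroup.
Variables (F : group_class) (tau : sfunctor).
Hypotheses (formF : formation F) (satF : saturated F).
Hypothesis superF : forall (rT : finGroupType) (H : {group rT}), supersoluble H -> F H.
Hypotheses (tauF : subgroup_functor tau) (tauH : hereditary tau).
Hypothesis tauQ : phi_quasiregular tau.

Lemma normal_pgroup_formation (p : nat) (gT : finGroupType) (G P : {group gT}) :
  prime p -> P <| G -> p.-group P -> tame_elements tau p G P -> F (G / P)%G -> F G.
Proof.
move=> p_pr; move: {2}_.+1 (ltnSn #|G|) => n; elim: n => // n IHG in G P *.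
rewrite ltnS => lenG nPG pP tP FGP.
(* Inside the induction on [|G|], a second one lowers [D] while [P] and its tame elements stay
   fixed. *)
suff main (D : {group gT}) : D <| G -> D \subset P -> F (G / D)%G -> F G by apply: (main P).
move: {2}_.+1 (ltnSn #|D|) => k; elim: k => // k IHD in D *.
rewrite ltnS => lenD nDG sDP FGD.
have [sPhi|nsPhi] := boolP (D \subset 'Phi(G)).
  exact: (saturated_sub_Phi formF satF nDG sPhi FGD).
have [M maxM nsDM] := not_sub_Phi (normal_sub nDG) nsPhi.
have pD := pgroupS sDP pP.
have pMG := maxgroupp maxM; have sMG := proper_sub pMG.
have IHM : F M.
  have [n1 n2] : P :&: M <| M /\ M \subset 'N(P).
    have nPM := subset_trans sMG (normal_norm nPG).
    by rewrite /normal subsetIr normsI ?normG.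
  apply: (IHG M (P :&: M)%G) => //; first exact: leq_trans (proper_card pMG) lenG.
  - exact: pgroupS (subsetIl _ _) pP.
  - have tPM := tame_elementsS tP (subsetIl P M).
    move=> x PMx; have [t1 t2] := tPM x PMx.
    have sxM : <[x]>%G \subset M by rewrite cycle_subG (subsetP (subsetIr P M)).
    have restr : tame tau G <[x]>%G -> tame tau M <[x]>%G.
      by apply: tame_restrict => //; case: tauH.
    by split=> [pr|p2 nab o4]; apply: restr; [apply: t1 | apply: t2].
  - apply: formation_isog FGP => //; rewrite isog_sym.
    have defG : M * P = G.
      rewrite (normC n2); apply: (maximal_supplement nPG maxM).
      by apply: contra nsDM; apply: subset_trans.
    by have := weak_second_isog n2; rewrite defG.
have FGN (N : {group gT}) : N <| G -> ~~ (N \subset M) -> F (G / N)%G.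
  move=> nNG nsN; have nNM := subset_trans sMG (normal_norm nNG).
  have defG : M * N = G by rewrite (normC nNM) (maximal_supplement nNG maxM).
  have FMN : F (M / (N :&: M))%G.
    by case: formF => _ h _; apply: h IHM; rewrite /normal subsetIr normsI ?normG.
  apply: formation_isog FMN => //.
  by have := weak_second_isog nNM; rewrite defG.
have nLG := maximal_cap_normal nDG pD maxM nsDM.
set L := (D :&: M)%G in nLG.
have pL : L \proper D.
  rewrite properEneq subsetIl andbT; apply: contra nsDM => /eqP <-; exact: subsetIr.
have sLD := proper_sub pL.
have sLP := subset_trans sLD sDP.
have ltD (N : {group gT}) : N \proper D -> #|N| < k.
  by move=> pN; apply: leq_trans (proper_card pN) lenD.
have IHL : F (G / L)%G -> F G by apply: IHD => //; apply: ltD.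
have [/existsP[N /and3P[nN pN nsN]]|/existsPn noN] :=
  boolP [exists N : {group gT}, [&& N <| G, N \proper D & ~~ (N \subset L)]].
  apply: (IHD N) => //; first exact: ltD.
    exact: subset_trans (proper_sub pN) sDP.
  by apply: FGN => //; apply: contra nsN; rewrite subsetI (proper_sub pN).
have chL (N : {group gT}) : N <| G -> N \subset D -> N :=: D \/ N \subset L.
  move=> nN sN; have := noN N; rewrite nN /= negb_and negbK.
  by case/orP=> [|]; [rewrite properEneq sN andbT negbK => /eqP; left | right].
have defL : D :&: M = L by [].
pose C := gcore_group M G.
have nCG : C <| G := gcore_normal sMG.
have capC : C :&: D = L := gcore_maximal_cap nLG defL.
have sLC : L \subset C by rewrite -capC subsetIl.
have defG : D * M = G := maximal_supplement nDG maxM nsDM.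
(* Since [C :&: D = L], [G / L] is subdirect in [G / C] and [G / D]; the inner induction then
   descends to [L]. *)
have FC_FG : F (G / C)%G -> F G.
  move=> FC; apply: IHL; apply: (formation_subdirect formF nCG nDG nLG) => //.
  by rewrite capC.
have [cL|ncL] := boolP (D \subset 'C(L)); last first.
  (* [U] is a minimal invariant subgroup of [L] not centralised by [D]. Nilpotence of [D] makes
     [[~: U, D]] smaller than [U], so [D] centralises it and it lies in [Z]. *)
  have [|U minU sUL] := @mingroup_exists _ (fun U : {group gT} => (G \subset 'N(U)) && ~~ (D \subset 'C(U))) L.
    by rewrite normal_norm.
  have [/andP[nUG ncU] {}minU] := mingroupP minU.
  have sUD := subset_trans sUL sLD.
  have nU : U <| G by rewrite /normal nUG (subset_trans sUD) ?normal_sub.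
  pose Z := 'C_U(D)%G.
  have nZ : Z <| G by apply: subcent_normal_group.
  have sUDU : [~: U, D] \subset U.
    by rewrite commg_subl (subset_trans (normal_sub nDG)).
  have sUDZ : [~: U, D] \subset Z.
    rewrite subsetI sUDU centsC; apply: contraT => nc.
    have ntU : U :!=: 1 by apply: contraNneq ncU => ->; rewrite cents1.
    have sDN : D \subset 'N_D(U) by rewrite subsetI subxx (subset_trans (normal_sub nDG)).
    have := nil_comm_properl (pgroup_nil pD) sUD ntU sDN.
    rewrite (minU [~: U, D]%G) ?properxx //= nc andbT.
    by rewrite normsR // normal_norm.
  apply: FC_FG; apply: (commutator_embedding_formation formF satF (p := p) nDG defG nCG nU nZ _ _ _ sUD _ sUDZ _ IHM).
  - by rewrite (subset_trans sUL) // -defL subsetIr.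
  - exact: subsetIl.
  - exact: pgroupS sUD pD.
  - by rewrite centsC subsetIr.
  have nCU : 'C_D(U) <| G by apply: subcent_normal_group.
  have [e|sCL] := chL 'C_D(U)%G nCU (subsetIl _ _).
    by case/negP: ncU; rewrite -e subsetIr.
  exact: subset_trans sCL sLC.
have sLZ : L \subset 'Z(D) by rewrite subsetI sLD centsC.
have sD := unique_max_normal_der pD nDG pL chL.
have sp := unique_max_normal_expgn pD nDG pL chL.
pose f := Morphism (crit_expM p_pr sD sLZ sp).
have kerG : 'ker f <| G.
  apply/andP; split; first by rewrite subIset ?(normal_sub nDG).
  apply/subsetP=> g Gg; rewrite inE; apply/subsetP=> _ /imsetP[d kd ->].
  have Dd := dom_ker kd; have fd := mker kd.
  have Ddg : d ^ g \in D by rewrite memJ_norm ?(subsetP (normal_norm nDG)).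
  by apply/kerP => //=; rewrite /= in fd; rewrite -conjXg fd conj1g.
(* If the kernel lies in [L], the power map is an equivariant map from [D] into [L], hence into [M],
   and [M] itself plays the part of the twisted wreath product. *)
have [kD|kL] := chL _ kerG (subsetIl _ _); last first.
  apply: FC_FG.
  apply: (@formation_equivariant_image F formF _ _ G D M C M 1%G (idm_morphism M) f) => //.
  - exact: normal1.
  - exact: morphim_idm.
  - exact: sub1G.
  - apply/subsetP=> _ /morphimP[d _ Dd ->].
    by apply: (subsetP (subsetIr D M)); apply: (crit_exp_mem sp).
  - by move=> d m Dd Mm /=; rewrite -conjXg.
  move=> d Dd fd1; apply: (subsetP sLC); apply: (subsetP kL).
  by apply/kerP => //; apply/set1gP.
have ex x : x \in D -> x ^+ crit_exp p D = 1.
  by move=> Dx; apply: (@mker _ _ _ f); rewrite kD.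
have prDL : prime #|D : L|.
  apply: (tame_maximal_chief_prime tauF (proj1 tauH) tauQ p_pr pD nDG nLG pL chL maxM nsDM defL).
  by move=> x Dx; apply: (tame_crit p_pr tP sDP Dx (ex x Dx)).
apply: IHL; apply: (@formation_prime_normal F formF satF superF _ (G / L)%G (D / L)%G).
- exact: quotient_normal.
- by rewrite card_quotient // (subset_trans (normal_sub nDG)) ?normal_norm.
- by apply: formation_isog FGD => //; rewrite isog_sym; apply: third_isog.
Qed.
End NormalPGroup.

Lemma order_coset_TI (gT : finGroupType) (N : {group gT}) x :
  x \in 'N(N) -> N :&: <[x]> = 1 -> #[coset N x] = #[x].
Proof.
move=> nNx ti; have nNX : <[x]> \subset 'N(N) by rewrite cycle_subG.
by have := card_isog (quotient_isog nNX ti); rewrite /= quotient_cycle.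
Qed.

Section Hereditary.
Variables (F : group_class) (tau : sfunctor).
Hypotheses (formF : formation F) (satF : saturated F).
Hypothesis superF : forall (rT : finGroupType) (H : {group rT}), supersoluble H -> F H.
Hypotheses (tauF : subgroup_functor tau) (tauH : hereditary tau).
Hypothesis tauQ : phi_quasiregular tau.

Let tauI : inductive tau := proj1 tauH.

Lemma hereditary_p'normalizers_central (gT : finGroupType) (G E : {group gT}) (p : nat) :
  E \subset G -> 1 < #|E| -> p = pdiv #|E| ->
  (forall P : {group gT}, p.-Sylow(E) P -> ~~ cyclic P -> tame_elements tau p G P) ->
  p'normalizers_central p E.
Proof.
move=> sEG E_gt1 defp hE; have p_pr : prime p by rewrite defp pdiv_prime.
apply: p'normalizers_central_criterion => // D L A sDE sAE pD p'A nDA nL pL chL cL defD ex.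
have nDM : D <| D <*> A by rewrite /normal joing_subl join_subG normG.
have [P sylP sDP] := Sylow_superset sDE pD.
have [cP|ncP] := boolP (cyclic P).
  exact: (unique_max_normal_cyclic_prime nDM nL pL chL (cyclicS sDP cP)).
have sME : D <*> A \subset E by rewrite join_subG sDE.
have sLD := proper_sub pL.
have sBM : L <*> A \subset D <*> A by rewrite genS ?setSU.
(* [L A] is proper because it meets [D] in [L]. A maximal subgroup of [D A] above it therefore meets
   [D] exactly in [L]. *)
have [eB|[M maxM sBM']] := maximal_exists sBM.
  case/negP: (proper_subn pL).
  have tiDA : D :&: A = 1 := coprime_TIg (pnat_coprime pD p'A).
  have eLA : L * A = D <*> A by rewrite -eB /= norm_joinEr // cents_norm.
  have : D \subset L * A by rewrite eLA joing_subl.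
  by move/setIidPl <-; rewrite setIC -group_modl // setIC tiDA mulg1.
have [sLM sAM] : L \subset M /\ A \subset M.
  by split; apply: subset_trans sBM'; rewrite ?joing_subl ?joing_subr.
have nsDM : ~~ (D \subset M).
  apply: contra (proper_subn (maxgroupp maxM)) => sDM.
  by rewrite join_subG sDM.
have defL : D :&: M = L.
  have [e|sL] := chL (D :&: M)%G (maximal_cap_normal nDM pD maxM nsDM) (subsetIl _ _).
    by case/negP: nsDM; rewrite -e subsetIr.
  by apply/eqP; rewrite eqEsubset sL subsetI sLD.
apply: (tame_maximal_chief_prime tauF tauI tauQ p_pr pD nDM nL pL chL maxM nsDM defL) => x Dx.
apply: (tame_restrict tauF tauI tauH (subset_trans sME sEG)).
  by rewrite cycle_subG (subsetP (normal_sub nDM)).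
exact: (tame_crit p_pr (hE P sylP ncP) sDP Dx (ex x Dx)).
Qed.

(** With [p] the least prime divisor of [|E|] and [N = 'O_p^'(E)], [E / N] is the image of a Sylow
    p-subgroup, so the p-group case or the cyclic case puts [G / N] in [F]; then [N] replaces
    [E]. *)
Lemma hereditary_formation (gT : finGroupType) (G E : {group gT}) :
  E <| G -> F (G / E)%G ->
  (forall (p : nat) (P : {group gT}), prime p -> p.-Sylow(E) P -> ~~ cyclic P ->
     tame_elements tau p G P) ->
  F G.
Proof.
move: {2}_.+1 (ltnSn #|E|) => n; elim: n => // n IH in E *.
rewrite ltnS => len nEG FGE hE; have sEG := normal_sub nEG.
have [E1|ntE] := eqVneq (E : {set gT}) 1.
  exact: (formation_quotient1 formF E1 FGE).
have E_gt1 : 1 < #|E| by rewrite cardG_gt1.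
set p := pdiv #|E|; have p_pr : prime p by rewrite pdiv_prime.
have cent := hereditary_p'normalizers_central sEG E_gt1 (erefl p) (fun P => hE p P p_pr).
have pEN := p'normalizers_central_pcore p_pr cent.
pose N := ('O_p^'(E))%G; rewrite -[X in #|_ : X|]/(N : {set gT}) in pEN.
have nNE : N <| E := pcore_normal _ _.
have nNG : N <| G := gFnormal_trans _ nEG.
have p'N : p^'.-group N := pcore_pgroup _ _.
have hallN : p^'.-Hall(E) N by rewrite /pHall (normal_sub nNE) p'N pnatNK.
have [_ nNGs] := andP nNG.
have [P sylP] := Sylow_exists p E; have [sPE pP p'P] := and3P sylP.
have defE : P * N = E.
  by apply: coprime_index_mulG; rewrite ?(normal_sub nNE) // coprime_sym (pnat_coprime pEN).
have defEN : E / N = P / N by rewrite -defE quotientMidr.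
have tiNP : N :&: P = 1 by rewrite setIC (coprime_TIg (pnat_coprime pP p'N)).
have sPG := subset_trans sPE sEG.
have FGN : F (G / N)%G.
  have FGNE : F (G / N / (E / N))%G.
    by apply: formation_isog FGE => //; rewrite isog_sym third_isog ?normal_sub.
  have nENG : E / N <| G / N by rewrite quotient_normal.
  have [cP|ncP] := boolP (cyclic P).
    apply: hypercyclic_formation FGNE => //; apply: cyclic_hypercyclic => //.
    by rewrite /= defEN quotient_cyclic.
  apply: (normal_pgroup_formation formF satF superF tauF tauH tauQ p_pr nENG _ _ FGNE).
    by rewrite /= defEN quotient_pgroup.
  have tP := hE p P p_pr sylP ncP.
  move=> xb; rewrite /= defEN => /morphimP[x nNx Px ->].
  have [t1 t2] := tP x Px.
  have sxP : <[x]> \subset P by rewrite cycle_subG.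
  have ti : N :&: <[x]> = 1 by apply/trivgP; rewrite -tiNP setIS.
  have ox := order_coset_TI nNx ti.
  have tq : tame tau G <[x]>%G -> tame tau (G / N)%G <[coset N x]>%G.
    move=> tx; rewrite (_ : <[coset N x]>%G = (<[x]> / N)%G); last first.
      by apply: val_inj; rewrite /= quotient_cycle.
    apply: tame_quotient => //; first exact: subset_trans sxP sPG.
    by rewrite coprime_sym (pnat_coprime (pgroupS sxP pP)).
  rewrite -[coset_morphism N x]/(coset N x) ox; split=> [prx|p2 nab o4].
    by apply: tq; apply: t1.
  by apply: tq; apply: t2 => //; apply: contra nab; apply: quotient_abelian.
apply: (IH N) => //.
  apply: leq_trans len; rewrite proper_card // properEneq (normal_sub nNE) andbT.
  apply: contraTneq p'N => ->; apply/negP => /pgroupP/(_ p p_pr (pdiv_dvd _)).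
  by rewrite !inE eqxx.
(* [N] is a Hall p'-subgroup of [E]: its Sylow r-subgroups are Sylow in [E] for [r] other than [p],
   and trivial for [r = p]. *)
move=> r R r_pr sylR ncR; apply: (hE r) => //.
have [e|ne] := eqVneq r p; last by apply: subHall_Sylow hallN _ sylR; rewrite !inE.
case/negP: ncR; suff -> : R :=: 1 by apply: cyclic1.
apply/eqP; rewrite trivg_card1 (card_Hall sylR) part_p'nat //.
by rewrite e.
Qed.
End Hereditary.

Theorem theoremB (F : group_class) (tau : sfunctor) (gT : finGroupType)
    (G E X : {group gT}) :
  formation F -> saturated F ->
  (forall (rT : finGroupType) (H : {group rT}), supersoluble H -> F rT H) ->
  subgroup_functor tau -> inductive tau ->
  X <| G -> E <| G -> X \subset E -> F _ (G / E)%G ->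
  (forall (p : nat) (P : {group gT}), prime p -> P \in 'Syl_p(X) -> ~~ cyclic P ->
     forall x : gT, x \in P ->
       (prime #[x] -> Ftau_supp supersoluble tau G <[x]>%G) /\
       (p = 2 -> ~~ abelian P -> #[x] = 4 -> Ftau_supp supersoluble tau G <[x]>%G)) ->
  [\/ [/\ hereditary tau, phi_quasiregular tau & X :=: E],
      [/\ hereditary tau, quasiregular tau, solvable E & X :=: 'F(E)]
    | regular tau /\ (X :=: genFitting E \/ X :=: E)] ->
  F gT G.
Proof.
move=> formF satF superF tauF tauI nXG nEG sXE FGE supp.
have hX (p : nat) (P : {group gT}) : prime p -> p.-Sylow(X) P -> ~~ cyclic P ->
    tame_elements tau p G P.
  move=> p_pr sylP ncP x Px; have SP : P \in 'Syl_p(X) by rewrite inE.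
  have px : p.-group <[x]> := mem_p_elt (pHall_pgroup sylP) Px.
  have [s1 s2] := supp p P p_pr SP ncP x Px.
  split=> [/s1|p2 nab o4]; first exact: Ftau_supp_tame px (cycle_cyclic x).
  exact: Ftau_supp_tame px (cycle_cyclic x) (s2 p2 nab o4).
case=> [[tauH tauQ eXE]|[_ tauQ solE eXF]|[tauR eX]].
- apply: (hereditary_formation formF satF superF tauF tauH tauQ nEG FGE).
  by rewrite -eXE.
- apply: (hypercyclic_formation formF satF superF _ FGE).
  apply: hypercyclic_Fitting => //.
  have -> : 'F(E)%G = X by apply: val_inj.
  apply: (tame_hypercyclic nXG tauF tauI tauQ _ hX).
  by right; apply: solvableS solE.
have hypX : hypercyclic G X.
  by apply: (tame_hypercyclic nXG tauF tauI (regular_quasiregular tauR) _ hX); left.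
apply: (hypercyclic_formation formF satF superF _ FGE).
case: eX => [eX|eX]; first exact: hypercyclic_genFitting eX hypX.
by have -> : E = X by apply: val_inj.
Qed.
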